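(* For every integer $k\geq 4$, \[ \mathrm{Ind}(SG_{2,k})\simeq \bigvee_{\frac{(k-3)(k-1)(k+4)}{6}-1}S^2, \] i.e. $\mathrm{Ind}(SG_{2,k})$ is homotopy equivalent to a wedge of $\frac{(k-3)(k-1)(k+4)}{6}-1$ two-dimensional spheres. Moreover, \[ \mathrm{Ind}(SG_{2,2})\simeq S^1 \vee S^1 \quad\text{and}\quad \mathrm{Ind}(SG_{2,3})\simeq S^1.\]
   Context: For integers $n\geq 1$, $k\geq 0$, the stable Kneser graph (Schrijver graph) $SG_{n,k}$ has as vertex set the stable $n$-subsets of $[2n+k]=\{1,\dots,2n+k\}$, where an $n$-subset is stable if it contains no $2$-subset of the form $\{i,i+1\}$ ($1\le i<2n+k$) or $\{1,2n+k\}$; two vertices are adjacent iff the corresponding subsets are disjoint. For a graph $G$, the independence complex $\mathrm{Ind}(G)$ is the simplicial complex whose vertex set is the vertex set of $G$ and whose faces are the independent sets of $G$ (sets of pairwise non-adjacent vertices). $\simeq$ denotes homotopy equivalence and $\vee$ denotes wedge sum. *)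

(* Defs.v *)
From HB Require Import structures.
From mathcomp Require Import all_boot all_order all_algebra.
From mathcomp Require Import all_classical all_reals all_analysis.
From mathcomp Require Import homotopy.
Import Order.TTheory GRing.Theory Num.Theory.
Import numFieldNormedType.Exports.

Set Implicit Arguments.
Unset Strict Implicit.
Unset Printing Implicit Defensive.

Local Open Scope classical_set_scope.
Local Open Scope ring_scope.

Record simplicial_complex (V : finType) := SimplicialComplex {
  faces :> {set {set V}};
  faces_vertex : forall v : V, [set v]%SET \in faces;
  faces_closed : forall A B : {set V},
    B \subset A -> A \in faces -> B \in faces }.

(* A point of the realization is given by its barycentric coordinates. Since V
   is finite, the topology of pointwise convergence on V -> R is the Euclidean
   one, and it induces the weak topology on the union of closed simplices. *)
Definition realization_set (R : realType) (V : finType)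
    (K : simplicial_complex V) : set {ptws V -> R} :=
  [set x : V -> R | [/\ forall v, 0 <= x v, \sum_v x v = 1
                      & [set v | x v != 0]%SET \in (K : {set {set V}})]].
Arguments realization_set R {V} K.

Definition realization (R : realType) (V : finType)
    (K : simplicial_complex V) : topologicalType :=
  set_type (realization_set R K).

Definition independent (V : finType) (e : rel V) (A : {set V}) : bool :=
  [forall x in A, forall y in A, (x != y) ==> ~~ e x y].

Section IndependenceComplex.
Variables (V : finType) (e : rel V).

Definition independent_sets : {set {set V}} :=
  [set A : {set V} | independent e A]%SET.

Fact independent_sets_vertex (v : V) : [set v]%SET \in independent_sets.
Proof.
rewrite inE; apply/forall_inP => x /set1P ->.
by apply/forall_inP => y /set1P ->; rewrite eqxx.
Qed.

Fact independent_sets_closed (A B : {set V}) :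
  B \subset A -> A \in independent_sets -> B \in independent_sets.
Proof.
move=> /fintype.subsetP sBA; rewrite !inE => /forall_inP indA.
apply/forall_inP => x /sBA/indA/forall_inP indAx.
by apply/forall_inP => y /sBA/indAx.
Qed.

Definition Ind : simplicial_complex V :=
  SimplicialComplex independent_sets_vertex independent_sets_closed.

End IndependenceComplex.

(* The element i of [m] = {1, ..., m} is represented by the ordinal i - 1. *)
Definition forbidden_pair (m : nat) (i j : 'I_m) : bool :=
  (j == i.+1 :> nat) || ((i == 0%N :> nat) && (j.+1 == m)).

Definition stable (m : nat) (A : {set 'I_m}) : bool :=
  [forall i, forall j, forbidden_pair i j ==> ~~ ([set i; j]%SET \subset A)].

Definition SG_vertex (n k : nat) : finType :=
  {A : {set 'I_(2 * n + k)%N} | (#|A| == n) && stable A}.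

Definition SG (n k : nat) : rel (SG_vertex n k) :=
  fun A B => (val A :&: val B == finset.set0)%SET.

Fact SG_sym (n k : nat) : symmetric (@SG n k).
Proof. by move=> A B; rewrite /SG finset.setIC. Qed.

Fact SG_irrefl (n k : nat) : (0 < n)%N -> irreflexive (@SG n k).
Proof.
move=> n0 A; apply/negbTE; rewrite /SG finset.setIid -card_gt0.
by have /andP[/eqP -> _] := valP A.
Qed.

Definition sphere_set (R : realType) (d : nat) : set 'rV[R]_d.+1 :=
  [set x | \sum_(i < d.+1) x 0 i ^+ 2 = 1].
Arguments sphere_set R d : clear implicits.

Definition sphere (R : realType) (d : nat) : topologicalType :=
  set_type (sphere_set R d).

Fact sphere_base_subproof (R : realType) (d : nat) :
  (delta_mx 0 0 : 'rV[R]_d.+1) \in sphere_set R d.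
Proof.
rewrite inE /sphere_set /= (bigD1 ord0) //= mxE !eqxx expr1n big1 ?addr0 //.
by move=> i /negbTE i0; rewrite mxE i0 andbF expr0n.
Qed.

Definition sphere_base (R : realType) (d : nat) : sphere R d :=
  exist _ (delta_mx 0 0) (sphere_base_subproof R d).

(* For m = 0 this is the empty space rather than a point. *)
Definition wedge_spheres (R : realType) (m d : nat) : topologicalType :=
  wedge (fun _ : 'I_m => sphere_base R d).

Definition homotopic (R : realType) (X Y : topologicalType) (f g : X -> Y) :=
  exists H : R * X -> Y,
    [/\ {within `[0, 1] `*` [set: X], continuous H},
        forall x, H (0, x) = f x & forall x, H (1, x) = g x].

Definition homotopy_equivalent (R : realType) (X Y : topologicalType) :=
  exists (f : X -> Y) (g : Y -> X),
    [/\ continuous f, continuous g,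
        homotopic R (g \o f) idfun & homotopic R (f \o g) idfun].

(* The division by 6 in the number of spheres is exact. *)
Fact wedge_number_dvd (k : nat) :
  (4 <= k)%N -> (6 %| (k - 3) * (k - 1) * (k + 4))%N.
Proof.
case: k => [|[|[|[|k]]]] // _; rewrite !subSS !subn0.
have -> : (k.+4 + 4 = k.+2 + 6)%N by rewrite -[k.+4]addn4 -[k.+2]addn2 -!addnA.
rewrite mulnDr; apply: dvdn_add; last exact: dvdn_mull.
suff -> : (k.+1 * k.+3 * k.+2 = 'C(k.+3, 3) * 3`!)%N by exact: dvdn_mull.
by rewrite bin_ffact !ffactnS ffactn0 muln1 /= mulnAC -mulnA mulnC -mulnA mulnCA.
Qed.

(* Main.v *)
(* Put m = k + 4. A vertex of SG_{2,k} is a chord of the m-cycle, and a set of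
   chords is independent iff its members pairwise meet, i.e. iff they share an
   endpoint or are the three sides of an independent triangle of the cycle. Up
   to homotopy this complex is the 2-skeleton of the independence complex of
   the m-cycle: the full simplex of chords at a point is contractible.

   A chord that lies in a single triangle can be deleted together with that
   triangle without changing the homotopy type, because its link then consists
   of two cones joined by an edge; so can a chord ending in a leaf. For k >= 4,
   leaving out all triangles except one for each edge outside a spanning tree,
   suitably chosen, such deletions reduce the rest of the complex to a point.
   A complex that is obtained from a contractible one by attaching maximal
   d-simplices is a wedge of d-spheres, one for each simplex, since collapsing
   the contractible part does not change the homotopy type. For k = 2 and k = 3
   all triangles can be deleted in this way, and what remains is a graph which
   becomes a tree after the removal of two edges, respectively one edge. *)

Require Import Defs.
From mathcomp Require Import all_boot all_order all_algebra.
From mathcomp Require Import all_classical all_reals all_analysis.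
From mathcomp Require Import homotopy.
From mathcomp Require Import ring lra zify.
Import Order.TTheory GRing.Theory Num.Theory.
Import numFieldNormedType.Exports.

Set Implicit Arguments.
Unset Strict Implicit.
Unset Printing Implicit Defensive.

Local Open Scope classical_set_scope.
Local Open Scope ring_scope.

(** The passage to the independence complex of the cycle is never carried out: the chords at a cycle
    vertex stay a full simplex, and every deletion is a push of barycentric coordinates towards an
    apex. A rank schedules the deletions, so that only chords of at least the current rank have to
    be examined.

    For [k >= 4] the spanning tree consists of the chords at 0 together with {1, 3} and {2, m-1}.
    Outside it, the C(k, 2) chords that avoid 0, 1 and m-1 are paired with the triangles at 0, and
    the other 2k - 1 chords with triangles that avoid 0. Since C(k+1, 3) triangles avoid 0, the
    number left over is C(k+1, 3) - (2k - 1), which equals the stated one.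

    Collapsing the contractible part requires two things: extending its contraction over the cells,
    done by an explicit formula, and descending to the wedge, where compactness makes the relevant
    maps closed. *)

(** * Continuity of maps built from real-valued functions *)

Lemma continuous_pair (X Y Z : topologicalType) (f : X -> Y) (g : X -> Z) :
  continuous f -> continuous g -> continuous (fun x => (f x, g x)).
Proof. by move=> cf cg x; apply: cvg_pair; [exact: cf|exact: cg]. Qed.

Lemma continuous_fst (X Y : topologicalType) : continuous (@fst X Y).
Proof. by move=> x; exact: cvg_fst. Qed.

Lemma continuous_snd (X Y : topologicalType) : continuous (@snd X Y).
Proof. by move=> x; exact: cvg_snd. Qed.

Lemma continuous_compose (X Y Z : topologicalType) (f : X -> Y) (g : Y -> Z) :
  continuous f -> continuous g -> continuous (fun x => g (f x)).
Proof. by move=> cf cg x; apply: continuous_comp; [exact: cf|exact: cg]. Qed.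

Lemma continuous_glue (X Y : topologicalType) (A B : set X) (f : X -> Y) :
  closed A -> closed B -> (forall x, A x \/ B x) ->
  {within A, continuous f} -> {within B, continuous f} -> continuous f.
Proof.
move=> cA cB AB fA fB; apply/continuous_subspace_setT.
have -> : [set: X] = A `|` B by rewrite eqEsubset; split => // x _; exact: AB.
exact: withinU_continuous.
Qed.

Section real_valued.
Variables (R : realType) (X : topologicalType).
Implicit Types f g : X -> R.

Lemma continuous_add f g :
  continuous f -> continuous g -> continuous (fun x => f x + g x).
Proof. by move=> cf cg x; apply: cvgD; [exact: cf|exact: cg]. Qed.

Lemma continuous_opp f : continuous f -> continuous (fun x => - f x).
Proof. by move=> cf x; apply: cvgN; exact: cf. Qed.

Lemma continuous_mul f g :
  continuous f -> continuous g -> continuous (fun x => f x * g x).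
Proof. by move=> cf cg x; apply: cvgM; [exact: cf|exact: cg]. Qed.

Lemma continuous_div f g : continuous f -> continuous g ->
  (forall x, g x != 0) -> continuous (fun x => f x / g x).
Proof.
move=> cf cg g0 x; apply: cvgM; first exact: cf.
by apply: cvgV; [exact: g0|exact: cg].
Qed.

Lemma continuous_max f g :
  continuous f -> continuous g -> continuous (fun x => Num.max (f x) (g x)).
Proof.
move=> cf cg.
exact: (continuous_compose (continuous_pair cf cg) (@max_continuous _ _)).
Qed.

Lemma continuous_min f g :
  continuous f -> continuous g -> continuous (fun x => Num.min (f x) (g x)).
Proof.
move=> cf cg.
exact: (continuous_compose (continuous_pair cf cg) (@min_continuous _ _)).
Qed.

Lemma continuous_const (c : R) : continuous (fun _ : X => c).
Proof. by move=> x; exact: cvg_cst. Qed.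

Lemma continuous_sum (I : Type) (r : seq I) (P : pred I) (F : I -> X -> R) :
  (forall i, continuous (F i)) -> continuous (fun x => \sum_(i <- r | P i) F i x).
Proof.
move=> cF; elim: r => [|i r IH].
  by under eq_fun do rewrite big_nil; exact: continuous_const.
under eq_fun do rewrite big_cons.
by case: (P i) => //; apply: continuous_add.
Qed.

Lemma continuous_bigmin (I : Type) (r : seq I) (P : pred I) (F : I -> X -> R) :
  (forall i, continuous (F i)) ->
  continuous (fun x => \big[Num.min/1]_(i <- r | P i) F i x).
Proof.
move=> cF; elim: r => [|i r IH].
  by under eq_fun do rewrite big_nil; exact: continuous_const.
under eq_fun do rewrite big_cons.
by case: (P i) => //; apply: continuous_min.
Qed.

Lemma closed_le f g : continuous f -> continuous g ->
  closed [set x | f x <= g x].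
Proof.
move=> cf cg.
have -> : [set x | f x <= g x] = (fun x => g x - f x) @^-1` [set y | 0 <= y].
  by apply/seteqP; split => x /=; rewrite subr_ge0.
have /continuous_closedP : continuous (fun x => g x - f x).
  by apply: continuous_add => //; exact: continuous_opp.
by apply; exact: closed_ge.
Qed.

End real_valued.

(** * Homotopy equivalence *)

Section homotopy_equivalence.
Variable R : realType.
Implicit Types X Y Z W : topologicalType.

Definition clamp (t : R) : R := Num.max 0 (Num.min t 1).

Lemma clamp_continuous : continuous clamp.
Proof.
apply: continuous_max; first exact: continuous_const.
by apply: continuous_min; [move=> ?|exact: continuous_const].
Qed.

Lemma clamp_ge0 t : 0 <= clamp t.
Proof. by rewrite le_max lexx. Qed.

Lemma clamp_le1 t : clamp t <= 1.
Proof. by rewrite ge_max ler01 ge_min lexx orbT. Qed.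

Lemma clamp_id t : 0 <= t <= 1 -> clamp t = t.
Proof. by move=> /andP[t0 t1]; rewrite /clamp (min_idPl t1) (max_idPr t0). Qed.

(** Precomposition with the retraction [clamp] of the line onto [[0, 1]] makes a homotopy continuous
    at all real times. Most later constructions can then ignore the subspace topology of the
    strip. *)
Lemma homotopicP X Y (f g : X -> Y) :
  homotopic R f g <-> exists H : R * X -> Y,
    [/\ continuous H, forall x, H (0, x) = f x & forall x, H (1, x) = g x].
Proof.
split=> [|] [H [cH H0 H1]]; last first.
  by exists H; split=> //; exact: continuous_subspaceT.
exists (fun p => H (clamp p.1, p.2)); split=> [|x|x] /=; last 2 first.
- by rewrite clamp_id ?lexx ?ler01.
- by rewrite clamp_id ?lexx ?ler01.
have cq : continuous (fun p : R * X => (clamp p.1, p.2)).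
  apply: continuous_pair; last exact: continuous_snd.
  apply: continuous_compose; [exact: continuous_fst|exact: clamp_continuous].
pose D : set (R * X) := `[0, 1] `*` [set: X].
suff cqD : continuous (fun p : R * X => (clamp p.1, p.2) : subspace D).
  exact: (continuous_compose cqD cH).
move=> x U; rewrite /= nbhs_simpl.
have Dx : D (clamp x.1, x.2).
  by split=> //=; rewrite in_itv /= clamp_ge0 clamp_le1.
rewrite {1}/nbhs /= -(nbhs_subspace_in Dx) => /cq xU.
apply: (@filterS _ (nbhs x) _ _ _ _ xU) => y; apply.
by split=> //=; rewrite in_itv /= clamp_ge0 clamp_le1.
Qed.

Lemma homotopic_refl X Y (f : X -> Y) : continuous f -> homotopic R f f.
Proof.
move=> cf; apply/homotopicP; exists (fun p => f p.2); split=> //.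
exact: continuous_compose (@continuous_snd _ _) cf.
Qed.

Lemma homotopic_sym X Y (f g : X -> Y) : homotopic R f g -> homotopic R g f.
Proof.
move=> /homotopicP[H [cH H0 H1]]; apply/homotopicP.
exists (fun p => H (1 - p.1, p.2)); split=> [|x|x]; rewrite ?subr0 ?subrr //.
apply: (continuous_compose _ cH); apply: continuous_pair.
  apply: continuous_add; first exact: continuous_const.
  by apply: continuous_opp; exact: continuous_fst.
exact: continuous_snd.
Qed.

Lemma homotopic_trans X Y (f g h : X -> Y) :
  homotopic R f g -> homotopic R g h -> homotopic R f h.
Proof.
move=> /homotopicP[H [cH H0 H1]] /homotopicP[K [cK K0 K1]]; apply/homotopicP.
pose L (p : R * X) :=
  if p.1 <= 2^-1 then H (p.1 *+ 2, p.2) else K (p.1 *+ 2 - 1, p.2).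
have c2 : continuous (fun p : R * X => p.1 *+ 2).
  by under eq_fun do rewrite mulr2n; apply: continuous_add; exact: continuous_fst.
have cfst : continuous (fun p : R * X => p.1) by exact: continuous_fst.
exists L; split=> [|x|x]; last 2 first.
- by rewrite /L /= invr_ge0 ler0n mul0rn.
- by rewrite /L /= leNgt invf_lt1 ?ltr0n // ltr1n /= -addrA subrr addr0.
apply: (@continuous_glue _ _ [set p : R * X | p.1 <= 2^-1]
                             [set p : R * X | 2^-1 <= p.1]).
- by apply: closed_le => //; exact: continuous_const.
- by apply: closed_le => //; exact: continuous_const.
- by move=> x /=; apply/orP; exact: le_total.
- apply: (@subspace_eq_continuous _ _ _ (fun p : R * X => H (p.1 *+ 2, p.2))).
    by move=> p; rewrite inE /= /from_subspace /L => ->.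
  apply: continuous_subspaceT; apply: (continuous_compose _ cH).
  by apply: continuous_pair => //; exact: continuous_snd.
apply: (@subspace_eq_continuous _ _ _ (fun p : R * X => K (p.1 *+ 2 - 1, p.2))).
  move=> p; rewrite inE /= /from_subspace /L => p1.
  case: ifPn => // p2; have -> : p.1 = 2^-1 by apply/eqP; rewrite eq_le p1 p2.
  have half2 : 2^-1 *+ 2 = 1 :> R by rewrite mulr2n -div1r -splitr.
  by rewrite half2 subrr K0 H1.
apply: continuous_subspaceT; apply: (continuous_compose _ cK).
apply: continuous_pair; last exact: continuous_snd.
by apply: continuous_add => //; exact: continuous_const.
Qed.

Lemma homotopic_comp X Y Z W (f : X -> Y) (g g' : Y -> Z) (h : Z -> W) :
  continuous f -> continuous h -> homotopic R g g' ->
  homotopic R (h \o g \o f) (h \o g' \o f).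
Proof.
move=> cf ch /homotopicP[H [cH H0 H1]]; apply/homotopicP.
exists (fun p => h (H (p.1, f p.2))); split=> [|x|x] /=; rewrite ?H0 ?H1 //.
apply: (continuous_compose _ ch); apply: (continuous_compose _ cH).
apply: continuous_pair; first exact: continuous_fst.
exact: continuous_compose (@continuous_snd _ _) cf.
Qed.

Lemma homotopy_equivalent_trans X Y Z :
  homotopy_equivalent R X Y -> homotopy_equivalent R Y Z ->
  homotopy_equivalent R X Z.
Proof.
move=> [f [g [cf cg gf fg]]] [f' [g' [cf' cg' gf' fg']]].
exists (f' \o f), (g \o g'); split.
- exact: continuous_compose cf cf'.
- exact: continuous_compose cg' cg.
- exact: homotopic_trans (homotopic_comp cf cg gf') gf.
- exact: homotopic_trans (homotopic_comp cg' cf' fg) fg'.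
Qed.

Lemma homotopy_equivalent_homeo X Y (f : X -> Y) (g : Y -> X) :
  continuous f -> continuous g -> cancel f g -> cancel g f ->
  homotopy_equivalent R X Y.
Proof.
move=> cf cg fK gK; exists f, g; split => //.
- have -> : g \o f = idfun by apply/funext => x; exact: fK.
  by apply: homotopic_refl => x.
- have -> : f \o g = idfun by apply/funext => x; exact: gK.
  by apply: homotopic_refl => x.
Qed.

Lemma homotopy_equivalent_refl X : homotopy_equivalent R X X.
Proof. by apply: (@homotopy_equivalent_homeo X X id id) => // x. Qed.

(** Continuity is asked at all real times, which by [homotopicP] is no restriction. *)
Definition contractible X :=
  exists (a : X) (H : R * X -> X),
    [/\ continuous H, forall x, H (0, x) = x & forall x, H (1, x) = a].

Lemma contractible_equivalent X Y :
  homotopy_equivalent R X Y -> contractible Y -> contractible X.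
Proof.
move=> [f [g [cf cg gf fg]]] [b [K [cK K0 K1]]].
exists (g b).
suff /homotopicP[H [cH H0 H1]] : homotopic R (@idfun X) (fun=> g b).
  by exists H; split.
apply: (homotopic_trans (homotopic_sym gf)).
have -> : (fun=> g b) = g \o (fun=> b) \o f by [].
have -> : g \o f = g \o idfun \o f by [].
by apply: homotopic_comp => //; apply/homotopicP; exists K; split.
Qed.

End homotopy_equivalence.

(** * Geometric realizations and collapses *)

Section realization.
Variables (R : realType) (V : finType).
Implicit Types (F : {set V} -> Prop) (x : V -> R).

Definition support x : {set V} := [set v | x v != 0]%SET.

(** The family of faces is an arbitrary predicate, so that subcomplexes arise by adding conditions
    to it; downward closure is assumed only where it is used. *)
Definition geom_set F : set {ptws V -> R} :=
  [set x : V -> R | [/\ forall v, 0 <= x v, \sum_v x v = 1 & F (support x)]].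
Arguments geom_set : clear implicits.

Definition geom F : topologicalType := set_type (geom_set F).

Definition bary F (x : geom F) : V -> R := set_val x.

Lemma geomP F (x : geom F) : geom_set F (bary x).
Proof. exact: set_mem (valP x). Qed.

Definition mk_geom F x (Fx : geom_set F x) : geom F := exist _ x (mem_set Fx).

Lemma bary_inj F (x y : geom F) : (forall v, bary x v = bary y v) -> x = y.
Proof. by move=> xy; apply: val_inj; exact/funext. Qed.

Lemma bary_ge0 F (x : geom F) v : 0 <= bary x v.
Proof. by have [] := geomP x. Qed.

Lemma bary_sum F (x : geom F) : \sum_v bary x v = 1.
Proof. by have [] := geomP x. Qed.

Lemma bary_face F (x : geom F) : F (support (bary x)).
Proof. by have [] := geomP x. Qed.

Lemma bary_le1 F (x : geom F) v : bary x v <= 1.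
Proof.
rewrite -(bary_sum x) (bigD1 v) //= lerDl sumr_ge0 // => w _.
exact: bary_ge0.
Qed.

Lemma bary_continuous F v : continuous (fun x : geom F => bary x v).
Proof.
have cval : continuous (@set_val _ (geom_set F) : geom F -> {ptws V -> R}).
  exact: initial_continuous.
have cpr := @proj_continuous V (fun=> R) v.
exact: (continuous_compose cval cpr).
Qed.

Lemma continuous_geom (Y : topologicalType) F (f : Y -> geom F) :
  (forall v, continuous (fun y => bary (f y) v)) -> continuous f.
Proof.
move=> cf; apply: continuous_comp_initial => y.
apply/cvg_sup => v; apply/cvg_image.
  by rewrite eqEsubset; split=> // r _; exists (fun=> r).
move=> W /= /cf yW; exists ((fun g : V -> R => g v) @^-1` W) => //.
by apply: image_preimage; rewrite eqEsubset; split=> // r _; exists (fun=> r).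
Qed.

End realization.
Arguments geom_set R {V} F.
Arguments geom R {V} F.

Section minimum.
Variables (R : realType) (V : finType).
Implicit Types (x : V -> R) (A : {set V}).

(** The neutral value 1 is harmless because barycentric coordinates are at most 1. This is a
    continuous test for [A] being contained in the support. *)
Definition minc A x : R := \big[Num.min/1]_(u in A) x u.

Lemma minc_le A x u : u \in A -> minc A x <= x u.
Proof. exact: bigmin_le_cond. Qed.

Lemma minc_ge0 A x : (forall u, 0 <= x u) -> 0 <= minc A x.
Proof. by move=> x0; apply/bigmin_geP; rewrite ler01. Qed.

Lemma minc_gt0 A x : (forall u, 0 <= x u) ->
  (0 < minc A x) = (A \subset support x).
Proof.
move=> x0; apply/bigmin_gtP/fintype.subsetP => [[_ h] u /h|h].
  by rewrite inE => /lt0r_neq0.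
by split=> // u /h; rewrite inE lt0r x0 andbT.
Qed.

Lemma minc_attained A x : A != finset.set0 -> (forall u, x u <= 1) ->
  exists2 u, u \in A & x u = minc A x.
Proof.
case/set0Pn => u uA x1.
have [v vA e] := eq_bigmin (x := 1) u (mem A) x uA (fun i _ => x1 i).
by exists v.
Qed.

Lemma minc_continuous F A : continuous (fun x : geom R F => minc A (bary x)).
Proof. by apply: continuous_bigmin => u; exact: bary_continuous. Qed.

End minimum.

Section compactness.
Variables (R : realType) (V : finType) (F : {set V} -> Prop).
Hypothesis F_down : forall A B : {set V}, B \subset A -> F A -> F B.

(** For a downward closed family, a set is a face iff it contains no nonface. That the support does
    not contain [S] means that [minc S] is not positive, which is a closed condition. *)
Lemma closed_geom_set : closed (geom_set R F).
Proof.
have cpr u : continuous (fun x : {ptws V -> R} => x u).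
  exact: (@proj_continuous V (fun=> R)).
have -> : geom_set R F =
    ((\bigcap_(u in [set: V]) [set x : {ptws V -> R} | 0 <= x u]) `&`
    ([set x : {ptws V -> R} | \sum_u x u <= 1] `&`
    [set x : {ptws V -> R} | 1 <= \sum_u x u])) `&`
    \bigcap_(S in [set S | ~ F S]) [set x : {ptws V -> R} | minc S x <= 0].
  apply/seteqP; split => x /=.
    case=> x0 x1 Fx; split; first by split=> [u _|]; [exact: x0|rewrite /= x1].
    move=> S /= FS; rewrite leNgt minc_gt0 //; apply/negP => Sx.
    exact: FS (F_down Sx Fx).
  case=> -[x0 [xle xge] Fx]; have {}x0 u : 0 <= x u by exact: x0.
  split=> //; first by apply/eqP; rewrite eq_le xle xge.
  apply: contrapT => /Fx /=; rewrite leNgt => /negP; apply.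
  by rewrite minc_gt0.
have csum : continuous (fun x : {ptws V -> R} => \sum_u x u).
  by apply: continuous_sum => u; exact: cpr.
apply: closedI; first apply: closedI.
- apply: closed_bigI => u _; apply: closed_le; last exact: cpr.
  exact: continuous_const.
- by apply: closedI; apply: closed_le => //; exact: continuous_const.
- apply: closed_bigI => S _; apply: closed_le; last exact: continuous_const.
  by apply: continuous_bigmin => u; exact: cpr.
Qed.

Lemma compact_set_type (X : topologicalType) (A : set X) :
  compact A -> compact [set: set_type A].
Proof.
move=> cA G PG _; have GA : (set_val @ G) A.
  apply: (@filterS _ G _ setT); last exact: filterT.
  by move=> x _; exact: set_mem (valP x).
have [] := cA (set_val @ G) (fmap_proper_filter _ _) GA.
move=> p [Ap clp]; exists (exist _ p (mem_set Ap)); split=> // B C GB.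
case=> _ /= [[W oW <-] Wp WC].
have GB' : (set_val @ G) (set_val @` B).
  by apply: (@filterS _ G _ B) => // x Bx; exists x.
have nW : nbhs p W by apply: open_nbhs_nbhs.
have [_ [[x Bx <-] Wx]] := clp _ _ GB' nW.
by exists x; split=> //; exact: WC.
Qed.

Lemma geom_compact : compact [set: geom R F].
Proof.
apply: compact_set_type.
have ccube := @tychonoff V (fun=> R) (fun=> `[0, 1]%classic)
  (fun=> @segment_compact R 0 1).
apply: (subclosed_compact closed_geom_set ccube).
move=> x Fx u; rewrite /= in_itv /=.
by have := bary_ge0 (mk_geom Fx) u; have := bary_le1 (mk_geom Fx) u => -> ->.
Qed.

End compactness.

Section collapse.
Variables (R : realType) (V : finType) (F : {set V} -> Prop).
Hypothesis F_down : forall A B : {set V}, B \subset A -> F A -> F B.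
Variables (tau : {set V}) (v : V).
Hypotheses (tau0 : tau != finset.set0) (vtau : v \notin tau).
Hypothesis tau_apex : forall A : {set V}, F A -> tau \subset A -> F (v |: A).

Let F' (A : {set V}) := F A /\ ~~ (tau \subset A).

(* Shift the mass that [x] puts uniformly on [tau] onto the apex [v]. *)
Let push (t : R) (x : V -> R) (u : V) : R :=
  x u - (u \in tau)%:R * (t * minc tau x) +
        (u == v)%:R * (t * minc tau x * #|tau|%:R).

Local Lemma push_sum t x : \sum_u push t x u = \sum_u x u.
Proof.
rewrite /push !big_split /= -[RHS]addr0 -addrA; congr (_ + _).
rewrite sumrN -!mulr_suml -!natr_sum.
have -> : (\sum_u (u \in tau) = #|tau|)%N by rewrite -big_mkcond sum1_card.
have -> : (\sum_u (u == v) = 1)%N.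
  by rewrite -big_mkcond (big_pred1 v).
by rewrite mul1r mulrC addNr.
Qed.

Local Lemma push_ge0 t x u : 0 <= t <= 1 -> (forall w, 0 <= x w) ->
  0 <= push t x u.
Proof.
move=> /andP[t0 t1] x0; have s0 := minc_ge0 tau x0.
rewrite /push; apply: addr_ge0; last by rewrite !mulr_ge0 ?ler0n.
rewrite subr_ge0; case: (boolP (u \in tau)) => ut; last by rewrite mul0r.
rewrite mul1r; apply: le_trans (minc_le x ut).
by rewrite ler_piMl.
Qed.

Local Lemma push_support t x : (forall w, 0 <= x w) -> F (support x) ->
  F (support (push t x)).
Proof.
move=> x0 Fx; have [tx|] := boolP (tau \subset support x).
  apply: F_down (tau_apex Fx tx); apply/fintype.subsetP => u.
  rewrite !inE; apply: contraNT; rewrite negb_or negbK => /andP[/negbTE uv /eqP xu].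
  rewrite /push uv mul0r addr0; case: (boolP (u \in tau)) => ut.
    by have := fintype.subsetP tx _ ut; rewrite inE xu eqxx.
  by rewrite mul0r subr0 xu.
rewrite -minc_gt0 // lt0r minc_ge0 // andbT negbK => /eqP s0.
have -> : push t x = x; last by [].
by apply/funext => u; rewrite /push s0 !(mulr0, mul0r) subr0 addr0.
Qed.

Local Lemma push_geom t (x : geom R F) : 0 <= t <= 1 ->
  geom_set R F (push t (bary x)).
Proof.
move=> t01; split=> [u||].
- by apply: push_ge0 => // w; exact: bary_ge0.
- by rewrite push_sum bary_sum.
- by apply: push_support; [move=> w; exact: bary_ge0|exact: bary_face].
Qed.

Local Lemma push_geom1 (x : geom R F) : geom_set R F' (push 1 (bary x)).
Proof.
have [p0 p1 Fp] := push_geom x (t := 1) ltac:(by rewrite ler01 lexx).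
split=> //; split=> //.
have [u ut ux] := minc_attained tau0 (bary_le1 x).
apply/negP => /fintype.subsetP/(_ u ut); rewrite inE.
have uv : u == v = false by apply: contraNF vtau => /eqP <-.
by rewrite /push ut uv mul0r addr0 !mul1r ux subrr eqxx.
Qed.

Local Lemma push0 x : push 0 x = x.
Proof. by apply/funext => u; rewrite /push !mul0r !mulr0 subr0 addr0. Qed.

Local Lemma push_continuous u : continuous
  (fun p : R * geom R F => push p.1 (bary p.2) u).
Proof.
have cs : continuous (fun p : R * geom R F => p.1 * minc tau (bary p.2)).
  apply: continuous_mul; first exact: continuous_fst.
  exact: (continuous_compose (@continuous_snd _ _) (@minc_continuous R V F tau)).
apply: continuous_add; first apply: continuous_add.
- exact: (continuous_compose (@continuous_snd _ _) (@bary_continuous R V F u)).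
- apply: continuous_opp; apply: continuous_mul => //; exact: continuous_const.
- apply: continuous_mul; first exact: continuous_const.
  by apply: continuous_mul => //; exact: continuous_const.
Qed.

(** At time 1 a smallest coordinate on [tau] has dropped to 0, so the point has left the open star
    of [tau]. Meanwhile the support gains at most the apex [v] and remains a face by [tau_apex], and
    points outside the open star do not move. *)
Lemma collapse : homotopy_equivalent R (geom R F) (geom R F').
Proof.
have F'F (x : geom R F') : geom_set R F (bary x).
  by have [x0 x1 [Fx _]] := geomP x; split.
pose f (x : geom R F) : geom R F' := mk_geom (push_geom1 x).
pose g (x : geom R F') : geom R F := mk_geom (F'F x).
have cg : continuous g.
  by apply: continuous_geom => u; exact: bary_continuous.
have cf : continuous f.
  apply: continuous_geom => u.
  have c1 : continuous (fun x : geom R F => (1 : R, x)).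
    by apply: continuous_pair; [exact: continuous_const|move=> ? ?].
  exact: (continuous_compose c1 (@push_continuous u)).
have fgE x : f (g x) = x.
  apply: bary_inj => u; rewrite -[LHS]/(push 1 (bary x) u) /push.
  have [_ _ [_ nx]] := geomP x; have x0 := bary_ge0 x.
  have -> : minc tau (bary x) = 0.
    by apply/eqP; move: nx; rewrite -minc_gt0 // lt0r minc_ge0 // andbT negbK.
  by rewrite !(mulr0, mul0r) subr0 addr0.
exists f, g; split=> //.
  apply: homotopic_sym; apply/homotopicP.
  have c01 (t : R) : 0 <= clamp t <= 1 by rewrite clamp_ge0 clamp_le1.
  exists (fun p => mk_geom (push_geom p.2 (c01 p.1))); split=> [|x|x].
  - apply: continuous_geom => u.
    have cc : continuous (fun p : R * geom R F => (clamp p.1, p.2)).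
      apply: continuous_pair; last exact: continuous_snd.
      exact: (continuous_compose (@continuous_fst _ _) (@clamp_continuous R)).
    exact: (continuous_compose cc (@push_continuous u)).
  - apply: bary_inj => u.
    rewrite -[LHS]/(push (clamp 0) (bary x) u).
    by rewrite clamp_id ?lexx ?ler01 // push0.
  - apply: bary_inj => u.
    rewrite -[LHS]/(push (clamp 1) (bary x) u).
    by rewrite clamp_id // ler01 lexx.
have -> : f \o g = idfun by apply/funext.
by apply: homotopic_refl => x.
Qed.

End collapse.

Lemma geom_ext (R : realType) (V : finType) (F F' : {set V} -> Prop) :
  (forall A, F A <-> F' A) -> geom R F = geom R F'.
Proof.
by move=> FF'; congr geom; apply/funext => A; exact/propext.
Qed.

Section vertex_removal.
Variables (R : realType) (V : finType) (F : {set V} -> Prop).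
Hypothesis F_down : forall A B : {set V}, B \subset A -> F A -> F B.
Variables e f g : V.
Hypotheses (ef : e != f) (eg : e != g) (Fefg : F [set e; f; g]%SET).
Hypothesis apex : forall u : V, u \notin [set e; f; g]%SET ->
  (forall A : {set V}, F A -> e \in A -> u \in A -> F (f |: A)) \/
  (forall A : {set V}, F A -> e \in A -> u \in A -> F (g |: A)).

Let G (s : seq V) (A : {set V}) := F A /\ (e \in A -> forall u, u \in s -> u \notin A).

Local Lemma G_down s (A B : {set V}) : B \subset A -> G s A -> G s B.
Proof.
move=> BA [FA eA]; split; first exact: F_down FA.
move=> eB u us; apply: contra (eA (fintype.subsetP BA _ eB) u us).
exact: fintype.subsetP.
Qed.

(** The edges from [e] to vertices [u] outside the triangle are cut one at a time: the faces
    containing [e] and [u] form a cone with apex [f] or [g]. Earlier cuts do no harm to this cone,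
    since they never concern [f] or [g]. *)
Local Lemma cut_edges (s : seq V) : {subset s <= ~: [set e; f; g]%SET} ->
  homotopy_equivalent R (geom R F) (geom R (G s)).
Proof.
elim: s => [|u s IH] sub.
  rewrite (@geom_ext R V F (G [::])); first exact: homotopy_equivalent_refl.
  by move=> A; split=> [FA|[]//]; split.
have {}IH : homotopy_equivalent R (geom R F) (geom R (G s)).
  by apply: IH => w ws; apply: sub; rewrite inE ws orbT.
apply: (homotopy_equivalent_trans IH).
have uefg : u \notin [set e; f; g]%SET.
  by have := sub u (mem_head _ _); rewrite inE.
have sN w : w \in s -> w \notin [set e; f; g]%SET.
  by move=> ws; have := sub w; rewrite !inE ws orbT; apply.
have step (v : V) : v \in [set f; g]%SET ->
    (forall A : {set V}, F A -> e \in A -> u \in A -> F (v |: A)) ->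
    homotopy_equivalent R (geom R (G s)) (geom R (G (u :: s))).
  move=> vfg av.
  have vu : v != u.
    by apply: contraNneq uefg => <-; move: vfg; rewrite !inE => /orP[] ->; rewrite ?orbT.
  have ve : v != e.
    by move: vfg; rewrite !inE => /orP[] /eqP ->; rewrite eq_sym.
  have -> : geom R (G (u :: s)) =
      geom R (fun A => G s A /\ ~~ ([set e; u]%SET \subset A)).
    apply: geom_ext => A; rewrite finset.subUset !finset.sub1set; split.
      case=> FA eA; split; first split=> //.
        by move=> eA' w ws; apply: eA => //; rewrite inE ws orbT.
      by apply/negP => /andP[eA' uA]; move/negP: (eA eA' u (mem_head _ _)).
    case=> -[FA eA]; rewrite negb_and => eu; split=> // eA' w.
    rewrite inE => /predU1P[->|]; last exact: eA.
    by move: eu; rewrite eA'.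
  apply: (@collapse R V _ _ _ v).
  - exact: G_down.
  - by apply/set0Pn; exists e; rewrite !inE eqxx.
  - by rewrite !inE negb_or ve vu.
  move=> A [FA eA]; rewrite finset.subUset !finset.sub1set => /andP[eA' uA].
  split; first exact: av.
  move=> _ w ws; rewrite !inE negb_or eA // andbT.
  apply: contraNneq (sN w ws) => ->.
  by move: vfg; rewrite !inE => /orP[] ->; rewrite ?orbT.
have [af|ag] := apex uefg.
- by apply: (step f) => //; rewrite !inE eqxx.
- by apply: (step g) => //; rewrite !inE eqxx orbT.
Qed.

(* If [f = g] this removes a vertex dominated by [f]; otherwise the link of
   [e] consists of a part coned off by [f] and a part coned off by [g], joined
   by the edge [f g]. *)
Lemma vertex_removal :
  homotopy_equivalent R (geom R F) (geom R (fun A => F A /\ e \notin A)).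
Proof.
pose s := enum (~: [set e; f; g]%SET).
apply: (homotopy_equivalent_trans (@cut_edges s _)).
  by move=> u; rewrite mem_enum.
have sub A : G s A -> e \in A -> A \subset [set e; f; g]%SET.
  move=> [_ eA] eA'; apply/fintype.subsetP => u; apply: contraLR => un.
  by apply: eA => //; rewrite mem_enum inE.
have -> : geom R (fun A => F A /\ e \notin A) =
    geom R (fun A => G s A /\ ~~ ([set e]%SET \subset A)).
  apply: geom_ext => A; rewrite finset.sub1set; split=> [[FA eA]|[[FA _] eA]].
    by split=> //; split=> // /(negP eA).
  by split.
apply: (@collapse R V _ _ _ f).
- exact: G_down.
- by apply/set0Pn; exists e; rewrite !inE eqxx.
- by rewrite inE eq_sym.
move=> A GA; rewrite finset.sub1set => eA.
have fA : f |: A \subset [set e; f; g]%SET.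
  by rewrite finset.subUset finset.sub1set !inE eqxx orbT sub.
split; first exact: F_down fA Fefg.
move=> _ u; rewrite mem_enum inE; apply: contra.
exact: fintype.subsetP.
Qed.

End vertex_removal.

(** * Maximal cells over a contractible complex *)

Lemma pair_hausdorff (X Y : topologicalType) :
  hausdorff_space X -> hausdorff_space Y -> hausdorff_space (X * Y)%type.
Proof.
move=> hX hY [x y] [x' y'] xy; congr pair.
- apply: hX => A B xA xB.
  have [] := xy (A `*` setT) (B `*` setT).
  + by exists (A, setT) => //; split=> //; exact: filterT.
  + by exists (B, setT) => //; split=> //; exact: filterT.
  by move=> [u v] [[Au _] [Bu _]]; exists u.
- apply: hY => A B xA xB.
  have [] := xy (setT `*` A) (setT `*` B).
  + by exists (setT, A) => //; split=> //; exact: filterT.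
  + by exists (setT, B) => //; split=> //; exact: filterT.
  by move=> [u v] [[_ Au] [_ Bu]]; exists v.
Qed.

Section collapse_contractible.
Variables (R : realType) (X W : topologicalType) (A : set X).
Variables (phi : X -> W) (H : R * X -> X).
Hypotheses (cX : compact [set: X]) (hW : hausdorff_space W).
Hypotheses (cphi : continuous phi) (phi_surj : forall w, exists x, phi x = w).
Hypothesis phi_fiber : forall x y, phi x = phi y -> x = y \/ (A x /\ A y).
Hypothesis phi_A : forall x y, A x -> A y -> phi x = phi y.
Hypotheses (cH : continuous H) (H0 : forall x, H (0, x) = x).
Hypothesis H_A : forall t x, A x -> A (H (t, x)).
Hypothesis H1_A : forall x y, A x -> A y -> H (1, x) = H (1, y).

(* [phi] and [id * phi] are closed maps by compactness, so whatever is constant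
   on the fibers of [phi] descends continuously to [W]. *)
Lemma quotient_contractible : homotopy_equivalent R X W.
Proof.
have [sec secK] := choice phi_surj.
have phiH t x y : phi x = phi y -> phi (H (t, x)) = phi (H (t, y)).
  by move=> /phi_fiber[->//|[Ax Ay]]; apply: phi_A; exact: H_A.
have H1phi x y : phi x = phi y -> H (1, x) = H (1, y).
  by move=> /phi_fiber[->//|[Ax Ay]]; exact: H1_A.
have cH1 : continuous (fun x => H (1, x)).
  apply: (continuous_compose _ cH).
  by apply: continuous_pair; [exact: continuous_const|move=> ? ?].
exists phi, (fun w => H (1, sec w)); split=> //.
- apply/continuous_closedP => C cC.
  have -> : (fun w => H (1, sec w)) @^-1` C = phi @` ((fun x => H (1, x)) @^-1` C).
    apply/seteqP; split=> [w /= Cw|_ [x /= Cx <-]].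
      by exists (sec w) => //=; rewrite secK.
    by rewrite /= (H1phi (sec (phi x)) x).
  apply: (compact_closed hW); apply: continuous_compact.
    exact: continuous_subspaceT.
  apply: (subclosed_compact _ cX) => //.
  by move/continuous_closedP: cH1; apply.
- apply: homotopic_sym; apply/homotopicP; exists H; split=> // x /=.
  by apply: H1phi; rewrite secK.
- apply: homotopic_sym.
  exists (fun p => phi (H (p.1, sec p.2))); split=> [|w|w] /=; rewrite ?H0 //.
  pose D : set (R * W) := `[0, 1] `*` [set: W].
  apply/(@continuous_closedP (subspace D)) => C cC.
  apply/closed_subspaceP.
  have cphiH : continuous (fun p => phi (H p)) by exact: continuous_compose cH cphi.
  pose E : set (R * X) := (`[0, 1] `*` [set: X]) `&` ((fun p => phi (H p)) @^-1` C).
  exists ((fun p : R * X => (p.1, phi p.2)) @` E).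
    apply: compact_closed; first exact: pair_hausdorff (@Rhausdorff R) hW.
    apply: continuous_compact.
      apply: continuous_subspaceT; apply: continuous_pair.
        exact: continuous_fst.
      exact: continuous_compose (@continuous_snd _ _) cphi.
    apply: compact_closedI; last by move/continuous_closedP: cphiH; apply.
    exact: compact_setX (@segment_compact R 0 1) cX.
  apply/seteqP; split=> [_ [[[t x] [[/= t01 _] Cx] <-] _]|[t w] [Cw [t01 _]]].
    split=> //=; rewrite /from_subspace /=.
    by rewrite (phiH t (sec (phi x)) x) ?secK.
  split=> //; exists (t, sec w); last by rewrite /= secK.
  by split.
Qed.

End collapse_contractible.

(** * Extending a contraction of the skeleton over maximal cells *)

Section cells.
Variables (R : realType) (V : finType) (F : {set V} -> Prop).
Hypothesis F_down : forall A B : {set V}, B \subset A -> F A -> F B.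
Implicit Types x : geom R F.
Variables (I : finType) (n : nat) (c : I -> {set V}).
Hypotheses (c_inj : injective c) (card_c : forall i, #|c i| = n.+1).
Hypothesis (c_face : forall i, F (c i)).
Hypothesis c_max : forall i (A : {set V}), F A -> c i \subset A -> A = c i.

(** Only the chosen cells are left out; other simplices of the same dimension may remain. *)
Definition skeleton (A : {set V}) := F A /\ forall i, A <> c i.

Let b : R := n.+1%:R^-1.

(** Normalized to be 1 at the barycenter of the cell. Since the cell is a maximal face, the depth is
    positive only at points whose support is the cell. *)
Definition depth i (x : geom R F) : R := n.+1%:R * minc (c i) (bary x).

Lemma depth_ge0 i x : 0 <= depth i x.
Proof. by rewrite mulr_ge0 // minc_ge0 // => u; exact: bary_ge0. Qed.

Lemma depth_gt0 i x : (0 < depth i x) = (support (bary x) == c i).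
Proof.
rewrite /depth pmulr_rgt0 ?ltr0n // minc_gt0; last exact: bary_ge0.
apply/idP/eqP => [|->//]; exact: c_max (bary_face x).
Qed.

Lemma depth_eq0 i x : (depth i x == 0) = (support (bary x) != c i).
Proof. by rewrite -depth_gt0 lt0r depth_ge0 andbT negbK. Qed.

Lemma depth_disjoint i j x : support (bary x) = c i -> j != i -> depth j x = 0.
Proof.
move=> xi ji; apply/eqP; rewrite depth_eq0 xi.
by apply: contraNneq ji => /c_inj ->.
Qed.

Lemma depth_skeleton x : skeleton (support (bary x)) -> forall i, depth i x = 0.
Proof. by move=> [_ nx] i; apply/eqP; rewrite depth_eq0; apply/eqP. Qed.

Lemma skeleton_depth x : (forall i, depth i x = 0) -> skeleton (support (bary x)).
Proof.
move=> d0; split=> [|i xi]; first exact: bary_face.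
by have /eqP := d0 i; rewrite depth_eq0 xi eqxx.
Qed.

Lemma depth_continuous i : continuous (depth i).
Proof.
apply: continuous_mul; first exact: continuous_const.
exact: minc_continuous.
Qed.

Lemma cell_sum i x : support (bary x) = c i -> \sum_(u in c i) bary x u = 1.
Proof.
move=> xi; rewrite -(bary_sum x) [RHS](bigID (mem (c i))) /= [X in _ + X]big1 ?addr0 //.
by move=> u; rewrite -xi inE negbK => /eqP.
Qed.

Lemma cell_P x : (forall i, depth i x = 0) \/ exists i, support (bary x) = c i.
Proof.
have [[i /eqP xi]|n_ex] := pselect (exists i, support (bary x) == c i).
  by right; exists i.
left=> i; apply/eqP; rewrite depth_eq0; apply/negP => xi.
by apply: n_ex; exists i.
Qed.

Section extension.
Variables (H : R * geom R skeleton -> geom R skeleton) (a : geom R skeleton).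
Hypotheses (cH : continuous H) (H0 : forall y, H (0, y) = y).
Hypothesis H1 : forall y, H (1, y) = a.

(** In a cell [1 - depth] is a radius, 0 at the barycenter and 1 on the boundary. Dividing the
    displacement from the barycenter by [den] changes this radius to the minimum of 1 and its
    multiple by [1 + t]. *)
Let den i (p : R * geom R F) : R :=
  Num.max (1 + clamp p.1)^-1 (1 - depth i p.2).

(* Radial push from the barycenter of the cell containing the point. *)
Let radial (p : R * geom R F) (u : V) : R :=
  bary p.2 u +
  \sum_i (u \in c i)%:R * (((den i p)^-1 - 1) * (bary p.2 u - b)).

(** The radius scaled by [1 + t]. A point whose height is at least 1 has been pushed to the boundary
    of its cell, and the excess [time] is left for the contraction [H]. On the skeleton the excess
    is [t] itself. *)
Let height (p : R * geom R F) : R :=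
  (1 + clamp p.1) * (1 - \sum_i depth i p.2).

Let time (p : R * geom R F) : R := Num.max 0 (height p - 1).

Local Lemma clamp1_gt0 (t : R) : 0 < 1 + clamp t.
Proof. by rewrite ltr_wpDr // clamp_ge0. Qed.

Local Lemma den_gt0 i p : 0 < den i p.
Proof. by rewrite lt_max invr_gt0 clamp1_gt0. Qed.

Local Lemma den_le1 i p : den i p <= 1.
Proof.
rewrite ge_max lerBlDr lerDl depth_ge0 andbT invf_le1 ?clamp1_gt0 //.
by rewrite lerDl clamp_ge0.
Qed.

Local Lemma den_skeleton i t x : depth i x = 0 -> den i (t, x) = 1.
Proof. by move=> d0; apply/le_anti; rewrite den_le1 le_max /= d0 subr0 lexx orbT. Qed.

Local Lemma radial_skeleton t x :
  (forall i, depth i x = 0) -> radial (t, x) = bary x.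
Proof.
move=> d0; apply/funext => u; rewrite /radial big1 ?addr0 // => i _.
by rewrite den_skeleton // invr1 subrr mul0r mulr0.
Qed.

Local Lemma radial_cell i t x u : support (bary x) = c i -> radial (t, x) u =
  if u \in c i then b + (den i (t, x))^-1 * (bary x u - b) else 0.
Proof.
move=> xi; rewrite /radial (bigD1 i) //= big1 ?addr0; last first.
  move=> j ji; rewrite den_skeleton ?invr1 ?subrr ?mul0r ?mulr0 //.
  exact: depth_disjoint ji.
case: ifPn => ui; first by rewrite mul1r; ring.
by rewrite mul0r addr0; apply/eqP; rewrite -xi inE negbK in ui.
Qed.

Local Lemma depth_cell_min i x : exists2 u, u \in c i &
  bary x u = b * depth i x.
Proof.
have [||u ui ux] := @minc_attained R V (c i) (bary x).
- by rewrite -card_gt0 card_c.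
- exact: bary_le1.
by exists u => //; rewrite ux /b /depth mulKf // pnatr_eq0.
Qed.

Local Lemma bary_ge_depth i x u : u \in c i -> b * depth i x <= bary x u.
Proof. by move=> ui; rewrite /b /depth mulKf ?pnatr_eq0 // minc_le. Qed.

(** Inside a cell, nonnegativity follows from [1 - depth <= den] and the bound [b * depth] below
    every coordinate. The total mass is kept because the displacements from the barycenter sum to
    0. *)
Local Lemma radial_geom p : geom_set R F (radial p).
Proof.
case: p => t x; have [d0|[i xi]] := cell_P x.
  by rewrite radial_skeleton //; exact: geomP.
have b_ge0 : 0 <= b by rewrite invr_ge0.
split=> [u||].
- rewrite (radial_cell _ _ xi); case: ifPn => // ui.
  rewrite -[X in X + _]opprK addrC subr_ge0 -ler_pdivrMl ?invr_gt0 ?den_gt0 //.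
  rewrite invrK mulrN lerNl opprB lerBlDr.
  apply: (@le_trans _ _ (b * (1 - depth i x) + b * depth i x)); last first.
    apply: lerD; last exact: bary_ge_depth.
    by rewrite mulrC ler_wpM2r // le_max lexx orbT.
  by rewrite mulrBr mulr1 subrK.
- under eq_bigr do rewrite (radial_cell _ _ xi).
  rewrite -big_mkcond /= big_split /= -mulr_sumr big_split /= (cell_sum xi).
  rewrite sumrN !sumr_const card_c -mulr_natr mulVf ?pnatr_eq0 //.
  by rewrite subrr mulr0 addr0.
- apply: F_down (c_face i); apply/fintype.subsetP => u; rewrite inE.
  by rewrite (radial_cell _ _ xi); case: ifP => //; rewrite eqxx.
Qed.

Local Lemma height_cell i t x : support (bary x) = c i ->
  height (t, x) = (1 + clamp t) * (1 - depth i x).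
Proof.
move=> xi; rewrite /height (bigD1 i) //= big1 ?addr0 // => j.
exact: depth_disjoint.
Qed.

(** In a cell, height at least 1 forces [den = 1 - depth], so a smallest coordinate [b * depth] is
    sent to [b - b = 0] and the support is no longer the whole cell. *)
Local Lemma radial_geom_skeleton p : 1 <= height p ->
  geom_set R skeleton (radial p).
Proof.
have [r0 r1 Fr] := radial_geom p; move=> h1; split=> //.
case: p r0 r1 Fr h1 => t x r0 r1 Fr h1; have [d0|[i xi]] := cell_P x.
  by rewrite radial_skeleton //; exact: skeleton_depth.
split=> // j rj.
have sub : support (radial (t, x)) \subset c i.
  apply/fintype.subsetP => u; rewrite inE (radial_cell _ _ xi).
  by case: ifP => //; rewrite eqxx.
have ij : c i = c j by apply: c_max => //; rewrite -rj.
have [u ui ux] := depth_cell_min i x.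
have : u \in support (radial (t, x)) by rewrite rj -ij.
rewrite inE (radial_cell _ _ xi) ui.
rewrite (height_cell _ xi) in h1.
have -> : den i (t, x) = 1 - depth i x.
  apply/max_idPr; rewrite /= -[leLHS]mulr1 ler_pdivrMl ?clamp1_gt0 //.
have d1 : 1 - depth i x != 0.
  by apply: contraTneq h1 => ->; rewrite mulr0 -ltNge ltr01.
have -> : (1 - depth i x)^-1 * (bary x u - b) = - b.
  by rewrite ux; field.
by rewrite subrr eqxx.
Qed.

(** [H] accepts only points of the skeleton, whose membership proof depends on the height; hence the
    case distinction by [pselect]. *)
Let extend (p : R * geom R F) : V -> R :=
  match pselect (1 <= height p) with
  | left h => bary (H (time p, mk_geom (radial_geom_skeleton h)))
  | right _ => radial p
  end.

Local Lemma extendE p (y : geom R skeleton) :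
  1 <= height p -> radial p = bary y -> extend p = bary (H (time p, y)).
Proof.
move=> h py; rewrite /extend; case: pselect => // h'; congr (bary (H (_, _))).
by apply: bary_inj => u; rewrite -py.
Qed.

Local Lemma extend_le p : height p <= 1 -> extend p = radial p.
Proof.
move=> h1; rewrite /extend; case: pselect => // h.
have -> : time p = 0 by rewrite /time; apply/max_idPl; rewrite subr_le0.
by rewrite H0.
Qed.

Local Lemma extend_geom p : geom_set R F (extend p).
Proof.
rewrite /extend; case: pselect => [h|_]; last exact: radial_geom.
by have [y0 y1 [Fy _]] := geomP (H (time p, mk_geom (radial_geom_skeleton h))).
Qed.

Local Lemma height_continuous : continuous height.
Proof.
apply: continuous_mul.
  apply: continuous_add; first exact: continuous_const.
  exact: (continuous_compose (@continuous_fst _ _) (@clamp_continuous R)).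
apply: continuous_add; first exact: continuous_const.
apply: continuous_opp; apply: continuous_sum => i.
exact: (continuous_compose (@continuous_snd _ _) (@depth_continuous i)).
Qed.

Local Lemma radial_continuous u : continuous (fun p => radial p u).
Proof.
have cu : continuous (fun p : R * geom R F => bary p.2 u).
  exact: (continuous_compose (@continuous_snd _ _) (@bary_continuous R V F u)).
apply: continuous_add => //; apply: continuous_sum => i.
apply: continuous_mul; first exact: continuous_const.
apply: continuous_mul; apply: continuous_add => //; try exact: continuous_const.
under eq_fun do rewrite -div1r.
apply: continuous_div; first exact: continuous_const.
  apply: continuous_max.
    under eq_fun do rewrite -div1r.
    apply: continuous_div; first exact: continuous_const.
      apply: continuous_add; first exact: continuous_const.
      exact: (continuous_compose (@continuous_fst _ _) (@clamp_continuous R)).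
    by move=> p; rewrite lt0r_neq0 // clamp1_gt0.
  apply: continuous_add; first exact: continuous_const.
  apply: continuous_opp.
  exact: (continuous_compose (@continuous_snd _ _) (@depth_continuous i)).
by move=> p; rewrite lt0r_neq0 // den_gt0.
Qed.

(** Two closed pieces are glued along height 1, where the remaining time is 0 and [H] is the
    identity. On the high piece continuity is checked on the subtype, over which the point of the
    skeleton is a function. *)
Local Lemma extend_continuous u : continuous (fun p => extend p u).
Proof.
pose hi := [set p : R * geom R F | 1 <= height p].
apply: (@continuous_glue _ _ hi [set p | height p <= 1]).
- by apply: closed_le; [exact: continuous_const|exact: height_continuous].
- by apply: closed_le; [exact: height_continuous|exact: continuous_const].
- by move=> p; apply/orP; exact: le_total.
- apply/subspace_sigL_continuousP.
  have chi : continuous (@set_val _ hi : set_type hi -> R * geom R F).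
    exact: initial_continuous.
  pose rad (p : set_type hi) : geom R skeleton :=
    mk_geom (radial_geom_skeleton (set_mem (valP p))).
  have crad : continuous rad.
    apply: continuous_geom => w.
    exact: (continuous_compose chi (@radial_continuous w)).
  have ctime : continuous (fun p : set_type hi => time (set_val p)).
    apply: (continuous_compose chi); apply: continuous_max.
      exact: continuous_const.
    apply: continuous_add; first exact: height_continuous.
    exact: continuous_const.
  have -> : sigL hi (fun p => extend p u) =
      fun p => bary (H (time (set_val p), rad p)) u.
    apply/funext => p; rewrite /sigL /=; congr (_ u).
    exact: extendE (set_mem (valP p)) _.
  have cHr := continuous_compose (continuous_pair ctime crad) cH.
  exact: (continuous_compose cHr (@bary_continuous R V skeleton u)).
apply: (@subspace_eq_continuous _ _ _ (fun p => radial p u)).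
  by move=> p; rewrite inE /= /from_subspace => /extend_le ->.
by apply: continuous_subspaceT; exact: radial_continuous.
Qed.

(* Homotopy extension for the pair (complex, skeleton). *)
Lemma extend_contraction : exists K : R * geom R F -> geom R F,
  [/\ continuous K, forall x, K (0, x) = x,
      forall t x, skeleton (support (bary x)) ->
        skeleton (support (bary (K (t, x)))) &
      forall x y, skeleton (support (bary x)) ->
        skeleton (support (bary y)) -> K (1, x) = K (1, y)].
Proof.
exists (fun p => mk_geom (extend_geom p)).
have sk t x (sx : geom_set R skeleton (bary x)) :
    extend (t, x) = bary (H (clamp t, mk_geom sx)).
  have [_ _ /depth_skeleton d0] := sx.
  have h : height (t, x) = 1 + clamp t.
    by rewrite /height big1 ?subr0 ?mulr1.
  rewrite (extendE _ (y := mk_geom sx)).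
  - by rewrite /time h addrAC subrr add0r (max_idPr (clamp_ge0 t)).
  - by rewrite h lerDl clamp_ge0.
  - by rewrite radial_skeleton.
have sk_geom x : skeleton (support (bary x)) -> geom_set R skeleton (bary x).
  by have [x0 x1 _] := geomP x; split.
split=> [|x|t x /sk_geom sx|x y /sk_geom sx /sk_geom sy].
- by apply: continuous_geom => u; exact: extend_continuous.
- apply: bary_inj => u; rewrite -[LHS]/(extend (0, x) u) extend_le.
    have den1 i : den i (0, x) = 1.
      apply/le_anti; rewrite den_le1 le_max /= clamp_id ?lexx ?ler01 //.
      by rewrite addr0 invr1 lexx.
    by rewrite /radial big1 ?addr0 // => i _; rewrite den1 invr1 subrr mul0r mulr0.
  rewrite /height /= clamp_id ?lexx ?ler01 // addr0 mul1r lerBlDr lerDl.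
  by apply: sumr_ge0 => i _; exact: depth_ge0.
- rewrite -[bary _]/(extend (t, x)) (sk _ _ sx).
  exact: bary_face.
- apply: bary_inj => u.
  rewrite -[LHS]/(extend (1, x) u) -[RHS]/(extend (1, y) u) !sk.
  by rewrite clamp_id ?lexx ?ler01 // !H1.
Qed.

End extension.
End cells.

(** * Maximal cells as the spheres of a wedge *)

Section sphere.
Variables (R : realType) (d : nat).

Lemma continuous_row (X : topologicalType) (f : X -> 'rV[R]_d.+1) :
  (forall j, continuous (fun x => f x 0 j)) -> continuous f.
Proof.
move=> cf x A [P xP PA].
have near0 (j : 'I_d.+1) : nbhs x [set y | P 0 j (f y 0 j)].
  exact: (cf j x (P 0 j) (xP 0 j)).
have nearP := filter_forall (nbhs_filter x) near0.
apply: (@filterS _ _ (nbhs_filter x) _ _ _ nearP) => y Py.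
by apply: PA => i j; rewrite ord1; exact: Py.
Qed.

Definition sphere_val (y : sphere R d) : 'rV[R]_d.+1 := set_val y.

Lemma sphere_val_continuous : continuous sphere_val.
Proof. exact: initial_continuous. Qed.

Lemma sphere_inj (y z : sphere R d) :
  (forall j, sphere_val y 0 j = sphere_val z 0 j) -> y = z.
Proof. by move=> yz; apply: val_inj; apply/rowP. Qed.

Lemma sphere_hausdorff : hausdorff_space (sphere R d).
Proof.
have hV : hausdorff_space 'rV[R]_d.+1 by exact: norm_hausdorff.
move=> x y xy; apply: val_inj; apply: hV => A B xA yB.
have [] := xy _ _ (@sphere_val_continuous x A xA) (@sphere_val_continuous y B yB).
by move=> z [Az Bz]; exists (sphere_val z).
Qed.

Lemma sphere_baseE j : sphere_val (sphere_base R d) 0 j = (j == ord0)%:R.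
Proof. by rewrite /sphere_val /= mxE eqxx. Qed.

End sphere.

(** The wedge maps to the product of the spaces, where each summand becomes a coordinate axis
    through the base point; comparing coordinates gives the two cases. *)
Lemma wedge_lift_eq (I : choiceType) (X : I -> topologicalType)
    (p0 : forall i, X i) (i j : I) (a : X i) (b : X j) :
  wedge_lift p0 a = wedge_lift p0 b ->
  (exists e : i = j, ecast k (X k) e a = b) \/ (a = p0 i /\ b = p0 j).
Proof.
move=> /(congr1 (@wedge_prod _ _ p0)).
rewrite /wedge_prod !wedge_lift_funE; do ?exact: wedge_prod_pointE.
move=> ab; have [e|ij] := pselect (i = j).
  left; exists e; case: j / e b ab => b /(congr1 (@^~ i)).
  by rewrite !dfwithin.
right; split.
- by move/(congr1 (@^~ i)): ab; rewrite dfwithin dfwithout //; apply/eqP => /esym.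
- by move/(congr1 (@^~ j)): ab; rewrite dfwithin dfwithout //; apply/eqP.
Qed.

Section wedge_of_spheres.
Variables (R : realType) (V : finType) (F : {set V} -> Prop).
Hypothesis F_down : forall A B : {set V}, B \subset A -> F A -> F B.
Variables (N d : nat) (c : 'I_N -> {set V}).
Hypotheses (c_inj : injective c) (card_c : forall i, #|c i| = d.+1).
Hypothesis (c_face : forall i, F (c i)).
Hypothesis c_max : forall i (A : {set V}), F A -> c i \subset A -> A = c i.
Implicit Types x y : geom R F.

Let label i (j : 'I_d.+1) : V := enum_val (cast_ord (esym (card_c i)) j).

Local Lemma label_inj i : injective (label i).
Proof. by move=> j k /enum_val_inj/cast_ord_inj. Qed.

Local Lemma label_in i j : label i j \in c i.
Proof. exact: enum_valP. Qed.

Local Lemma labelP i u : u \in c i -> exists j, u = label i j.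
Proof.
move=> ui; exists (cast_ord (card_c i) (enum_rank_in ui u)).
by rewrite /label cast_ordK enum_rankK_in.
Qed.

Local Lemma sum_label i (w : V -> R) : \sum_(u in c i) w u = \sum_j w (label i j).
Proof.
rewrite big_enum_val (reindex (cast_ord (esym (card_c i)))) //=.
by exists (cast_ord (card_c i)) => j _; rewrite ?cast_ordK ?cast_ordKV.
Qed.

Let low i x : R := minc (c i) (bary x).

(** Coordinates relative to the vertex [label i ord0]: the component at [ord0] vanishes, which
    leaves [d] free ones. *)
Let diff i x j : R := bary x (label i j) - bary x (label i ord0).

(* The last term vanishes on the cell; it keeps the denominator of
   [sphere_coord] positive elsewhere. *)
Let msq i x : R :=
  \sum_j diff i x j ^+ 2 + (1 - \sum_(u in c i) bary x u) ^+ 2.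

Let den i x : R := msq i x + low i x ^+ 2.

(* Inverse stereographic projection of the point [diff / low], which tends to
   infinity, i.e. to the base point, at the boundary of the cell. *)
Let sphere_coord i x (j : 'I_d.+1) : R :=
  if j == ord0 then (msq i x - low i x ^+ 2) / den i x
  else 2 * low i x * diff i x j / den i x.

Local Lemma low_ge0 i x : 0 <= low i x.
Proof. by apply: minc_ge0 => u; exact: bary_ge0. Qed.

Local Lemma low_gt0 i x : (0 < low i x) = (support (bary x) == c i).
Proof.
rewrite -(@depth_gt0 _ _ _ _ d _ c_max) /depth.
by rewrite pmulr_rgt0 ?ltr0n.
Qed.

Local Lemma low_eq0 i x : (low i x == 0) = (support (bary x) != c i).
Proof. by rewrite -low_gt0 lt0r low_ge0 andbT negbK. Qed.

Local Lemma low_le i x j : low i x <= bary x (label i j).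
Proof. exact: minc_le (label_in i j). Qed.

Local Lemma low_attained i x : exists j, bary x (label i j) = low i x.
Proof.
have [||u ui ux] := @minc_attained R V (c i) (bary x).
- by rewrite -card_gt0 card_c.
- exact: bary_le1.
by have [j uj] := labelP ui; exists j; rewrite -uj.
Qed.

Local Lemma msq_ge0 i x : 0 <= msq i x.
Proof. by rewrite addr_ge0 ?sqr_ge0 // sumr_ge0 // => j _; exact: sqr_ge0. Qed.

(** If both terms vanished, all coordinates on the cell would equal their minimum 0, although the
    last term of [msq] forces them to sum to 1. *)
Local Lemma sphere_den_gt0 i x : 0 < den i x.
Proof.
rewrite lt0r addr_ge0 ?sqr_ge0 ?msq_ge0 // andbT.
rewrite paddr_eq0 ?sqr_ge0 ?msq_ge0 // sqrf_eq0 negb_and.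
have [l0|] := eqVneq (low i x) 0; last by rewrite orbT.
rewrite orbF paddr_eq0 ?sqr_ge0 //; last by rewrite sumr_ge0 // => j _; exact: sqr_ge0.
rewrite negb_and orbC sqrf_eq0 subr_eq0 eq_sym.
have [s1|//] := eqVneq (\sum_(u in c i) bary x u) 1.
rewrite psumr_eq0 => [|j _]; last exact: sqr_ge0.
apply/negP => /allP dj.
have d0 j : bary x (label i j) = bary x (label i ord0).
  by have := dj j (mem_index_enum _); rewrite sqrf_eq0 subr_eq0 => /eqP.
have [k xk] := low_attained i x.
have : \sum_(u in c i) bary x u = 0.
  by rewrite sum_label big1 // => j _; rewrite d0 -(d0 k) xk.
by move/eqP; rewrite s1 oner_eq0.
Qed.

Local Lemma diff0 i x : diff i x ord0 = 0.
Proof. by rewrite /diff subrr. Qed.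

(** Where [low] is positive the point lies inside the cell and no mass is outside. This removes the
    correcting term of [msq] from identities multiplied by [low]. *)
Local Lemma low_rest i x :
  low i x * (1 - \sum_(u in c i) bary x u) = 0.
Proof.
have [l0|] := boolP (support (bary x) == c i); last first.
  by rewrite -low_eq0 => /eqP ->; rewrite mul0r.
by rewrite (cell_sum (eqP l0)) subrr mulr0.
Qed.

Local Lemma low_msq i x :
  low i x ^+ 2 * msq i x = low i x ^+ 2 * \sum_j diff i x j ^+ 2.
Proof. by rewrite /msq mulrDr -exprMn low_rest expr0n addr0. Qed.

Local Lemma sphere_coord_sphere i x :
  sphere_set R d (\row_j sphere_coord i x j).
Proof.
rewrite /sphere_set /=; under eq_bigr do rewrite mxE.
have den0 := lt0r_neq0 (sphere_den_gt0 i x).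
rewrite big_ord_recl /= /sphere_coord /=.
have -> : \sum_(j < d) (2 * low i x * diff i x (lift ord0 j) / den i x) ^+ 2 =
    4 * (low i x ^+ 2 * msq i x) / den i x ^+ 2.
  rewrite low_msq big_ord_recl diff0 expr0n add0r mulr_sumr mulr_sumr mulr_suml.
  by apply: eq_bigr => j _; field.
rewrite /den in den0 *; field.
exact: den0.
Qed.

Definition cell_map i x : sphere R d :=
  exist _ (\row_j sphere_coord i x j) (mem_set (sphere_coord_sphere i x)).

Local Lemma cell_mapE i x j : sphere_val (cell_map i x) 0 j = sphere_coord i x j.
Proof. by rewrite /sphere_val /= mxE. Qed.

Local Lemma low_continuous i : continuous (low i).
Proof. exact: minc_continuous. Qed.

Local Lemma diff_continuous i j : continuous (fun x => diff i x j).
Proof.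
by apply: continuous_add; [|apply: continuous_opp]; exact: bary_continuous.
Qed.

Local Lemma msq_continuous i : continuous (msq i).
Proof.
apply: continuous_add.
  apply: continuous_sum => j; under eq_fun do rewrite expr2.
  by apply: continuous_mul; exact: diff_continuous.
have cr : continuous (fun x => 1 - \sum_(u in c i) bary x u).
  apply: continuous_add; first exact: continuous_const.
  by apply: continuous_opp; apply: continuous_sum => u; exact: bary_continuous.
by under eq_fun do rewrite expr2; exact: continuous_mul.
Qed.

Lemma cell_map_continuous i : continuous (cell_map i).
Proof.
have cl2 : continuous (fun x => low i x ^+ 2).
  by under eq_fun do rewrite expr2; apply: continuous_mul; exact: low_continuous.
have cden : continuous (den i).
  by apply: continuous_add => //; exact: msq_continuous.
have den0 x : den i x != 0 by rewrite lt0r_neq0 // sphere_den_gt0.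
apply: continuous_comp_initial; apply: continuous_row => j.
have -> : (fun x => (set_val \o cell_map i) x 0 j) = (fun x => sphere_coord i x j).
  by apply/funext => x; rewrite -cell_mapE.
rewrite /sphere_coord; case: (j == ord0); apply: continuous_div => //.
- by apply: continuous_add; [exact: msq_continuous|exact: continuous_opp].
- apply: continuous_mul; last exact: diff_continuous.
  by apply: continuous_mul; [exact: continuous_const|exact: low_continuous].
Qed.

Lemma cell_map_base i x :
  (cell_map i x = sphere_base R d) <-> support (bary x) <> c i.
Proof.
split=> [/(congr1 (fun z => sphere_val z 0 ord0))|/eqP].
  rewrite cell_mapE sphere_baseE /sphere_coord !eqxx => h.
  have e : msq i x - low i x ^+ 2 = den i x.
    by rewrite -[LHS](divfK (lt0r_neq0 (sphere_den_gt0 i x))) h mul1r.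
  have : low i x ^+ 2 == 0 by apply/eqP; move: e; rewrite /den; lra.
  by rewrite sqrf_eq0 low_eq0 => /eqP.
rewrite -low_eq0 => /eqP l0; apply: sphere_inj => j.
rewrite cell_mapE sphere_baseE /sphere_coord l0 mulr0 !mul0r expr0n subr0.
case: eqP => // _; rewrite /den l0 expr0n addr0 divff //.
by have := sphere_den_gt0 i x; rewrite /den l0 expr0n addr0 => /lt0r_neq0.
Qed.

(** Stereographic projection from the base point recovers the vector [p = diff / low]. Where [p] is
    smallest the coordinate equals [low], so every coordinate is [low * (1 - min p + p j)], and the
    total mass 1 then determines [low]. *)
Lemma cell_map_inj i x y : support (bary x) = c i -> support (bary y) = c i ->
  cell_map i x = cell_map i y -> x = y.
Proof.
move=> xi yi xy.
pose stereo (q : sphere R d) (j : 'I_d.+1) : R :=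
  if j == ord0 then 0 else sphere_val q 0 j / (1 - sphere_val q 0 ord0).
have coordE z : support (bary z) = c i ->
    0 < low i z /\ (forall j, diff i z j = low i z * stereo (cell_map i z) j).
  move=> zi; have l0 : 0 < low i z by rewrite low_gt0 zi eqxx.
  split=> // j; rewrite /stereo; case: eqP => [->|/eqP j0]; first by rewrite diff0 mulr0.
  rewrite !cell_mapE /sphere_coord eqxx (negbTE j0).
  have den0 := lt0r_neq0 (sphere_den_gt0 i z); have l0' := lt0r_neq0 l0.
  have -> : 1 - (msq i z - low i z ^+ 2) / den i z = 2 * low i z ^+ 2 / den i z.
    by rewrite /den in den0 *; field; exact: den0.
  by field; rewrite den0 l0'.
have [lx dx] := coordE x xi; have [ly dy] := coordE y yi.
rewrite xy in dx; set p := stereo (cell_map i y) in dx dy.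
have [jx jxE] := low_attained i x; have [jy jyE] := low_attained i y.
have bx j : bary x (label i j) = bary x (label i ord0) + low i x * p j.
  by rewrite -dx addrC subrK.
have by_ j : bary y (label i j) = bary y (label i ord0) + low i y * p j.
  by rewrite -dy addrC subrK.
have minx j : p jx <= p j.
  have := low_le i x j; rewrite -jxE (bx j) (bx jx) lerD2l.
  by rewrite ler_pM2l.
have miny j : p jy <= p j.
  by have := low_le i y j; rewrite -jyE (by_ j) (by_ jy) lerD2l ler_pM2l.
have pE : p jx = p jy by apply/le_anti; rewrite minx miny.
have x0 : bary x (label i ord0) = low i x * (1 - p jx).
  by rewrite mulrBr mulr1 -[X in X - _]jxE (bx jx) addrK.
have y0 : bary y (label i ord0) = low i y * (1 - p jx).
  by rewrite mulrBr mulr1 -[X in X - _]jyE (by_ jy) pE addrK.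
pose T := \sum_j (1 - p jx + p j).
have sx : low i x * T = 1.
  rewrite mulr_sumr -[RHS](cell_sum xi) sum_label; apply: eq_bigr => j _.
  by rewrite (bx j) x0 mulrDr.
have sy : low i y * T = 1.
  rewrite mulr_sumr -[RHS](cell_sum yi) sum_label; apply: eq_bigr => j _.
  by rewrite (by_ j) y0 mulrDr.
have T0 : T != 0 by apply: contraPneq sx => ->; rewrite mulr0 => /esym/eqP; rewrite oner_eq0.
have lE : low i x = low i y by apply: (mulIf T0); rewrite sx sy.
apply: bary_inj => u; have [ui|ui] := boolP (u \in c i).
  by have [j ->] := labelP ui; rewrite (bx j) (by_ j) x0 y0 lE.
have := ui; rewrite -{1}xi inE negbK => /eqP ->.
by have := ui; rewrite -yi inE negbK => /eqP ->.
Qed.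

(** From the stereographic projection [p] of [q], weights proportional to [p j + 1 - p m] are
    formed, where [p m] is the minimum. The smallest weight is 1, so dividing by the total [T] gives
    [low = 1 / T] and [diff / low = p]. *)
Lemma cell_map_surj i (q : sphere R d) : q <> sphere_base R d ->
  exists2 x, support (bary x) = c i & cell_map i x = q.
Proof.
move=> qb; pose y j := sphere_val q 0 j.
have ysum : \sum_j y j ^+ 2 = 1 by exact: set_mem (valP q).
have a0 : 1 - y ord0 != 0.
  apply/eqP => /eqP; rewrite subr_eq0 => /eqP y1; apply: qb.
  move: ysum; rewrite big_ord_recl -y1 expr1n -[RHS]addr0 => /addrI /eqP.
  rewrite psumr_eq0 => [|j _]; last exact: sqr_ge0.
  move=> /allP yj; apply: sphere_inj => j; rewrite sphere_baseE.
  case: (unliftP ord0 j) => [k ->|->]; last by rewrite eqxx -/(y ord0) -y1.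
  by have := yj k (mem_index_enum _); rewrite sqrf_eq0 => /eqP.
pose p j := if j == ord0 then 0 else y j / (1 - y ord0).
pose m := [arg min_(j < ord0 | true) p j]%O.
have mP j : p m <= p j by rewrite /m; case: arg_minP => // k _; apply.
pose r j := p j + 1 - p m.
have r1 j : 1 <= r j by rewrite /r addrAC lerDr subr_ge0.
have rm : r m = 1 by rewrite /r addrAC subrr add0r.
have r0 j : 0 <= r j by exact: le_trans ler01 (r1 j).
pose T := \sum_j r j.
have T1 : 1 <= T by rewrite /T (bigD1 m) //= rm lerDl sumr_ge0.
have T0 : 0 < T by exact: lt_le_trans ltr01 T1.
have T0' := lt0r_neq0 T0.
pose w u := \sum_j (u == label i j)%:R * (r j / T).
have w_label k : w (label i k) = r k / T.
  rewrite /w (bigD1 k) //= eqxx mul1r big1 ?addr0 // => j jk.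
  by rewrite (inj_eq (@label_inj i)) eq_sym (negbTE jk) mul0r.
have w_out u : u \notin c i -> w u = 0.
  move=> ui; rewrite /w big1 // => j _.
  by case: eqP => [uj|_]; [move: ui; rewrite uj label_in|rewrite mul0r].
have wsum : \sum_(u in c i) w u = 1.
  rewrite sum_label; under eq_bigr do rewrite w_label.
  by rewrite -mulr_suml divff.
have wg : geom_set R F w.
  split=> [u||].
  - apply: sumr_ge0 => j _; rewrite mulr_ge0 ?ler0n // divr_ge0 //.
    exact: ltW.
  - rewrite (bigID (mem (c i))) /= wsum big1 ?addr0 // => u; exact: w_out.
  - apply: F_down (c_face i); apply/fintype.subsetP => u; rewrite inE.
    by apply: contraNT => /w_out ->.
pose x : geom R F := mk_geom wg.
have xE : bary x = w by [].
have lowE : low i x = T^-1.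
  apply/le_anti/andP; split.
    by have := low_le i x m; rewrite xE w_label rm div1r.
  have [k <-] := low_attained i x; rewrite xE w_label.
  by rewrite -[leLHS]mul1r ler_pM2r ?invr_gt0.
have p0 : p ord0 = 0 by rewrite /p eqxx.
have diffE j : diff i x j = p j / T.
  by rewrite /diff xE !w_label /r p0; field.
pose P := \sum_j p j ^+ 2.
have PE : P = (1 + y ord0) / (1 - y ord0).
  have : P * (1 - y ord0) ^+ 2 = 1 - y ord0 ^+ 2.
    rewrite -[X in _ = X - _]ysum /P !big_ord_recl p0 expr0n add0r addrAC subrr add0r mulr_suml.
    by apply: eq_bigr => j _; rewrite /p /= exprMn exprVn divfK // sqrf_eq0.
  move=> e; apply: (mulIf (x := (1 - y ord0) ^+ 2)); first by rewrite sqrf_eq0.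
  by rewrite e; field.
have msqE : msq i x = P / T ^+ 2.
  rewrite /msq xE wsum subrr expr0n addr0 /P mulr_suml.
  by apply: eq_bigr => j _; rewrite diffE exprMn exprVn.
have denE : den i x = 2 / ((1 - y ord0) * T ^+ 2).
  by rewrite /den msqE lowE PE; field; rewrite T0'.
exists x.
  by apply/eqP; rewrite -low_gt0 lowE invr_gt0.
apply: sphere_inj => j; rewrite cell_mapE /sphere_coord denE msqE lowE diffE PE.
case: (eqVneq j ord0) => [->|j0]; rewrite -/(y _).
  by field; rewrite T0'.
by rewrite /p (negbTE j0) -/(y _); field; rewrite T0' a0.
Qed.

Variable i0 : 'I_N.

Let base : 'I_N -> sphere R d := fun=> sphere_base R d.

Let into i (q : sphere R d) : wedge_spheres R N d :=
  @wedge_lift _ (fun=> sphere R d) base i q.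

(** The default [i0] is used on the skeleton, where the choice does not matter: every cell map sends
    such a point to the base point. *)
Definition pick_cell x : 'I_N := odflt i0 [pick i | support (bary x) == c i].

Definition cells_to_wedge x : wedge_spheres R N d :=
  into (pick_cell x) (cell_map (pick_cell x) x).

Local Lemma cells_to_wedge_cell i x : support (bary x) = c i ->
  cells_to_wedge x = into i (cell_map i x).
Proof.
move=> xi; rewrite /cells_to_wedge /pick_cell; case: pickP => [j /eqP|/(_ i)].
  by rewrite xi => /c_inj ->.
by rewrite xi eqxx.
Qed.

Local Lemma cells_to_wedge_skeleton i x : (forall j, support (bary x) <> c j) ->
  cells_to_wedge x = into i (cell_map i x).
Proof.
move=> nx; rewrite /cells_to_wedge.
have -> j : cell_map j x = base j by apply/cell_map_base; exact: nx.
have -> : cell_map i x = base i by apply/cell_map_base; exact: nx.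
exact: (@wedge_liftE _ (fun=> sphere R d) base i (base i) _
  (base (pick_cell x))).
Qed.

(** At a skeleton point every cell map goes to the base point, so the neighborhoods for the finitely
    many cells can be intersected. Inside a cell, positivity of [low] keeps nearby points in the
    same cell. *)
Local Lemma cells_to_wedge_continuous : continuous cells_to_wedge.
Proof.
have clift i : continuous (fun x => into i (cell_map i x)).
  exact: (continuous_compose (@cell_map_continuous i) (@wedge_lift_continuous _ _ base i)).
move=> x U xU; have [d0|[i xi]] := cell_P d c_max x.
  have [_ nx] := skeleton_depth c_max d0.
  have near i : nbhs x [set y | U (into i (cell_map i y))].
    by apply: (clift i x U); rewrite -(cells_to_wedge_skeleton i nx).
  have nearU := filter_forall (nbhs_filter x) near.
  apply: (@filterS _ _ (nbhs_filter x) _ _ _ nearU) => y; exact.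
have near : nbhs x [set y | U (into i (cell_map i y))].
  by apply: (clift i x U); rewrite -(cells_to_wedge_cell xi).
have pos : nbhs x [set y | 0 < low i y].
  apply: (@low_continuous i x [set t : R | 0 < t]).
  apply: open_nbhs_nbhs; split; first exact: open_gt.
  by rewrite /= low_gt0 xi eqxx.
apply: (@filterS _ _ (nbhs_filter x) _ _ _ (filterI near pos)) => y [Uy].
by rewrite /= low_gt0 => /eqP yi; rewrite /preimage /= (cells_to_wedge_cell yi).
Qed.

Lemma wedge_of_maximal_cells :
  contractible R (geom R (skeleton F c)) ->
  homotopy_equivalent R (geom R F) (wedge_spheres R N d).
Proof.
move=> [a [H [cH H0 H1]]].
have [K [cK K0 KA K1]] :=
  extend_contraction F_down c_inj card_c c_face c_max cH H0 H1.
have skelP x : ~ skeleton F c (support (bary x)) -> exists i, support (bary x) = c i.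
  move=> nx; have [d0|//] := cell_P d c_max x.
  by have := nx (skeleton_depth c_max d0).
pose A := [set x : geom R F | skeleton F c (support (bary x))].
(* The base point of the wedge needs a preimage, and the skeleton, being contractible, provides a
   point. *)
have xa_geom : geom_set R F (bary a) by have [a0 a1 [Fa _]] := geomP a.
pose xa : geom R F := mk_geom xa_geom.
have Aa : A xa by exact: bary_face a.
apply: (@quotient_contractible R _ _ A cells_to_wedge K) => //.
- exact: geom_compact.
- by apply: wedge_hausdorff => i; exact: sphere_hausdorff.
- exact: cells_to_wedge_continuous.
- move=> w; have : [set: wedge_spheres R N d] w by [].
  rewrite -[X in X w]wedgeTE => -[i _ [q _ <-]].
  have [->|/eqP qb] := eqVneq q (sphere_base R d).
    exists xa; rewrite (cells_to_wedge_skeleton i); last by case: Aa.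
    congr into; apply/cell_map_base; by case: Aa.
  have [x xi <-] := cell_map_surj i qb; exists x.
  exact: cells_to_wedge_cell.
- move=> x y xy.
  have [Ax|nAx] := pselect (A x); have [Ay|nAy] := pselect (A y).
  + by right.
  + have [j yj] := skelP y nAy; move: xy.
    rewrite (cells_to_wedge_cell yj) (cells_to_wedge_skeleton j); last by case: Ax.
    have -> : cell_map j x = base j by apply/cell_map_base; case: Ax.
    move=> /esym/wedge_lift_eq [[e]|[/cell_map_base//]].
    by rewrite (eq_irrelevance e erefl) /= => /cell_map_base.
  + have [j yj] := skelP x nAx; move: xy.
    rewrite (cells_to_wedge_cell yj) (cells_to_wedge_skeleton j); last by case: Ay.
    have -> : cell_map j y = base j by apply/cell_map_base; case: Ay.
    move=> /wedge_lift_eq [[e]|[/cell_map_base//]].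
    by rewrite (eq_irrelevance e erefl) /= => /cell_map_base.
  have [i xi] := skelP x nAx; have [j yj] := skelP y nAy; left.
  move: xy; rewrite (cells_to_wedge_cell xi) (cells_to_wedge_cell yj).
  move=> /wedge_lift_eq [[e]|[/cell_map_base//]].
  case: j / e yj => yi /= ; exact: cell_map_inj.
- move=> x y [Fx nx] [Fy ny].
  rewrite (cells_to_wedge_skeleton i0 nx) (cells_to_wedge_skeleton i0 ny).
  by congr into; rewrite !(iffRL (cell_map_base _ _)).
Qed.

End wedge_of_spheres.

(** * Complexes of chords *)

(** The removed vertices [D] always form a lower set for the rank, so the cone condition is needed
    only on faces of rank at least [r e]. Vertices of equal rank may go in any order, because [f]
    and [g] have strictly larger rank and are still present. *)
Lemma homotopy_equivalent_strip (R : realType) (V : finType)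
    (F : {set V} -> Prop) (r : V -> nat) (top : nat) :
  (forall A B : {set V}, B \subset A -> F A -> F B) ->
  (forall e, (r e < top)%N -> F [set e]%SET -> exists f g : V,
    [/\ (r e < r f)%N, (r e < r g)%N, F [set e; f; g]%SET &
      forall u, u \notin [set e; f; g]%SET ->
      (forall A : {set V}, F A -> (forall a, a \in A -> r e <= r a)%N ->
        e \in A -> u \in A -> F (f |: A)) \/
      (forall A : {set V}, F A -> (forall a, a \in A -> r e <= r a)%N ->
        e \in A -> u \in A -> F (g |: A))]) ->
  homotopy_equivalent R (geom R F)
    (geom R (fun A => F A /\ forall e, e \in A -> (top <= r e)%N)).
Proof.
move=> Fd step.
pose G (D : {set V}) (A : {set V}) := F A /\ forall e, e \in D -> e \notin A.
have Gd D (A B : {set V}) : B \subset A -> G D A -> G D B.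
  move=> BA [FA DA]; split=> [|e eD]; first exact: Fd FA.
  by apply: contra (DA e eD); exact: fintype.subsetP.
suff strip (n : nat) (D : {set V}) :
    #|[set e | (r e < top)%N] :\: D|%SET = n ->
    D \subset [set e | (r e < top)%N]%SET ->
    (forall e u, e \in D -> u \notin D -> (r e <= r u)%N) ->
    homotopy_equivalent R (geom R (G D))
      (geom R (fun A => F A /\ forall e, e \in A -> (top <= r e)%N)).
  have -> : geom R F = geom R (G finset.set0).
    apply: geom_ext => A; split=> [FA|[]//]; split=> // e.
    by rewrite inE.
  by apply: (strip _ _ erefl) => [|e u]; rewrite ?finset.sub0set ?inE.
elim: n D => [|n IH] D.
  move/eqP; rewrite cards_eq0 finset.setD_eq0 => QD DQ _.
  have -> : D = [set e | (r e < top)%N]%SET by apply/eqP; rewrite finset.eqEsubset DQ.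
  rewrite (@geom_ext R V _ (fun A => F A /\ forall e, e \in A -> (top <= r e)%N)).
    exact: homotopy_equivalent_refl.
  move=> A; split=> -[FA h]; split=> // e.
    by apply: contraTT; rewrite -ltnNge => et; apply: h; rewrite inE.
  by rewrite inE; apply: contraTN; rewrite -leqNgt; exact: h.
move=> Dn DQ D_low.
have /set0Pn[e1] : [set e | (r e < top)%N]%SET :\: D != finset.set0.
  by rewrite -cards_eq0 Dn.
rewrite !inE => De1.
(* Minimality extends to all vertices outside [D], since those not below [top] have larger rank
   anyway. *)
pose e := [arg min_(x < e1 | (x \notin D) && (r x < top)%N) r x].
have [eD et emin] : [/\ e \notin D, (r e < top)%N &
    forall u, u \notin D -> (r e <= r u)%N].
  rewrite /e; case: arg_minnP => //= x /andP[xD xt] xmin; split=> // u uD.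
  have [ut|/(leq_trans (ltnW xt))//] := ltnP (r u) top.
  by apply: xmin; rewrite uD.
have D_le u : u \in D -> (r u <= r e)%N by move=> uD; exact: D_low.
have IHe : homotopy_equivalent R (geom R (G (e |: D)))
    (geom R (fun A => F A /\ forall e, e \in A -> (top <= r e)%N)).
  apply: IH.
  - have -> : ([set x | (r x < top)%N] :\: (e |: D) =
              ([set x | (r x < top)%N] :\: D) :\ e)%SET.
      by apply/finset.setP => x; rewrite !inE negb_or -andbA.
    apply: (@addnI 1); rewrite [RHS]add1n -Dn [RHS](cardsD1 e).
    by rewrite !inE eD et.
  - by rewrite finset.subUset finset.sub1set inE et.
  - move=> a u; rewrite !inE negb_or => /orP[/eqP->|aD] /andP[ue uD].
      exact: emin.
    exact: D_low.
apply: homotopy_equivalent_trans IHe.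
have -> : geom R (G (e |: D)) = geom R (fun A => G D A /\ e \notin A).
  apply: geom_ext => A; split=> [[FA h]|[[FA h] eA]].
    split; last by apply: h; rewrite !inE eqxx.
    by split=> // a aD; apply: h; rewrite !inE aD orbT.
  by split=> // a; rewrite !inE => /orP[/eqP->|/h].
(* A vertex that is not a face lies in no face at all, so excluding it changes nothing. *)
have [Fe|nFe] := pselect (F [set e]%SET); last first.
  rewrite (@geom_ext R V _ (G D)); first exact: homotopy_equivalent_refl.
  move=> A; split=> [[]//|GA]; split=> //; apply/negP => eA; apply: nFe.
  by case: GA => FA _; apply: Fd FA; rewrite finset.sub1set.
have [f [g [ef eg Fefg apex]]] := step e et Fe.
have fD : f \notin D by apply: contraL ef => /D_le; rewrite -leqNgt.
have gD : g \notin D by apply: contraL eg => /D_le; rewrite -leqNgt.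
apply: (@vertex_removal R V _ _ e f g).
- exact: Gd.
- by apply: contraTneq ef => <-; rewrite ltnn.
- by apply: contraTneq eg => <-; rewrite ltnn.
- split=> // a aD; rewrite !inE !negb_or.
  by rewrite -andbA; apply/and3P; split; apply: contraTneq aD => ->.
move=> u /apex[af|ag]; [left|right] => A [FA DA] eA uA.
- have Ar a : a \in A -> (r e <= r a)%N.
    by move=> aA; apply: emin; apply: contraL aA; exact: DA.
  split; first exact: af.
  by move=> a aD; rewrite !inE negb_or DA // andbT; apply: contraNneq fD => <-.
- have Ar a : a \in A -> (r e <= r a)%N.
    by move=> aA; apply: emin; apply: contraL aA; exact: DA.
  split; first exact: ag.
  by move=> a aD; rewrite !inE negb_or DA // andbT; apply: contraNneq gD => <-.
Qed.

Lemma point_contractible (R : realType) (V : finType) (F : {set V} -> Prop) v :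
  F [set v]%SET -> (forall A : {set V}, F A -> A \subset [set v]%SET) ->
  contractible R (geom R F).
Proof.
move=> Fv F1.
have all_eq (x y : geom R F) : x = y.
  have E (z : geom R F) u : bary z u = (u == v)%:R.
    have z0 w : w != v -> bary z w = 0.
      move=> wv; apply/eqP; apply: contraNT wv => zw.
      by have /fintype.subsetP/(_ w) := F1 _ (bary_face z); rewrite !inE => /(_ zw).
    have [->|/z0//] := eqVneq u v.
    have := bary_sum z; rewrite (bigD1 v) //= big1 ?addr0 // => w; exact: z0.
  by apply: bary_inj => u; rewrite !E.
have pv : geom_set R F (fun u => (u == v)%:R).
  split=> [u||]; first by rewrite ler0n.
    by rewrite (bigD1 v) //= eqxx big1 ?addr0 // => w /negbTE ->.
  rewrite (_ : support _ = [set v]%SET) //; apply/finset.setP => u.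
  by rewrite !inE; case: (u == v); rewrite ?oner_eq0 ?eqxx.
exists (mk_geom pv), (fun=> mk_geom pv); split=> // x.
by move=> U; exact: cvg_cst.
Qed.

Lemma wedge_of_cells (R : realType) (V : finType) (F : {set V} -> Prop)
    (C : {set {set V}}) (d : nat) :
  (forall A B : {set V}, B \subset A -> F A -> F B) ->
  (forall S, S \in C -> [/\ #|S| = d.+1, F S &
    forall A : {set V}, F A -> S \subset A -> A = S]) ->
  (0 < #|C|)%N ->
  contractible R (geom R (fun A => F A /\ A \notin C)) ->
  homotopy_equivalent R (geom R F) (wedge_spheres R #|C| d).
Proof.
move=> Fd FC C0 ctr; pose c (i : 'I_#|C|) := enum_val i.
have cP i := FC (c i) (enum_valP i).
apply: (@wedge_of_maximal_cells R V F Fd #|C| d c _ _ _ _ (Ordinal C0)).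
- exact: enum_val_inj.
- by move=> i; have [] := cP i.
- by move=> i; have [] := cP i.
- by move=> i; have [] := cP i.
have -> : geom R (skeleton F c) = geom R (fun A => F A /\ A \notin C); last by [].
apply: geom_ext => A; split=> -[FA nA]; split=> //.
  apply/negP => CA; apply: (nA (enum_rank_in CA A)).
  by rewrite /c enum_rankK_in.
by move=> i Ai; move: nA; rewrite Ai enum_valP.
Qed.

Section chords.
Variables (V : finType) (lft rgt : V -> nat).
Hypothesis lft_rgt : forall e, (lft e < rgt e)%N.
Hypothesis chord_inj : forall e e', lft e = lft e' -> rgt e = rgt e' -> e = e'.

Definition inc (v : nat) (e : V) : bool := (v == lft e) || (v == rgt e).

(** For a triangle with vertices a < b < c the sides are listed in the fixed order ab, bc, ac. *)
Definition triangle (e1 e2 e3 : V) : bool :=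
  [&& lft e3 == lft e1, lft e2 == rgt e1 & rgt e3 == rgt e2].

(* Edges [E], full stars at the vertices in [P], and the triangles in [T]; the
   third argument of [T] is the largest vertex of the triangle. *)
Definition chord_complex (E : pred V) (P : pred nat) (T : nat -> nat -> pred nat)
    (A : {set V}) : Prop :=
  (forall e, e \in A -> E e) /\
  ((exists2 v, P v & forall e, e \in A -> inc v e) \/
   (exists e1 e2 e3, [/\ triangle e1 e2 e3, T (lft e1) (rgt e1) (rgt e2) &
     A = [set e1; e2; e3]%SET])).

Lemma triangle_card e1 e2 e3 : triangle e1 e2 e3 -> #|[set e1; e2; e3]%SET| = 3.
Proof.
move=> /and3P[/eqP h1 /eqP h2 /eqP h3].
have l1 := lft_rgt e1; have l2 := lft_rgt e2; have l3 := lft_rgt e3.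
have e12 : e1 != e2 by apply: contraTneq l1 => e; rewrite -h2 e ltnn.
have e23 : e2 != e3.
  by apply/eqP => e; move: h1 h2 l1; rewrite -e => <- <-; rewrite ltnn.
have e13 : e1 != e3.
  by apply/eqP => e; move: h2 h3 l2; rewrite -e => <- <-; rewrite ltnn.
by rewrite -finset.setUA cardsU1 cards2 !inE negb_or e12 e13 e23.
Qed.

Lemma triangle_no_star e1 e2 e3 v : triangle e1 e2 e3 ->
  ~~ [&& inc v e1, inc v e2 & inc v e3].
Proof.
move=> /and3P[/eqP h1 /eqP h2 /eqP h3]; rewrite /inc.
by have := lft_rgt e1; have := lft_rgt e2; have := lft_rgt e3; lia.
Qed.

Lemma inc_two a b v e : a != b -> inc a e -> inc b e -> inc v e ->
  v = a \/ v = b.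
Proof.
by rewrite /inc => ab /orP[] /eqP ae /orP[] /eqP be /orP[] /eqP ve; lia.
Qed.

Lemma inc_inj a b e e' : a != b -> inc a e -> inc b e -> inc a e' -> inc b e' ->
  e = e'.
Proof.
have l := lft_rgt e; have l' := lft_rgt e'; rewrite /inc => ab.
by do 4!(case/orP=> /eqP ?); apply: chord_inj; lia.
Qed.

Lemma inc_lt a b e : (a < b)%N -> inc a e -> inc b e -> lft e = a /\ rgt e = b.
Proof.
have l := lft_rgt e; rewrite /inc => ab.
by do 2!(case/orP=> /eqP ?); split; lia.
Qed.

Section complex.
Variables (E : pred V) (P : pred nat) (T : nat -> nat -> pred nat).
Hypothesis PT : forall a b c, T a b c -> [/\ P a, P b & P c].

Local Notation K := (chord_complex E P T).

Lemma chord_complex_star (A : {set V}) v : P v ->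
  (forall e, e \in A -> E e && inc v e) -> K A.
Proof.
move=> Pv AE; split=> [e /AE/andP[]//|].
by left; exists v => // e /AE/andP[].
Qed.

(** A triangle that loses a side becomes part of the star at the vertex opposite to that side; [PT]
    guarantees that this star belongs to the complex. *)
Lemma chord_complex_down (A B : {set V}) : B \subset A -> K A -> K B.
Proof.
move=> BA [AE h]; split=> [e /(fintype.subsetP BA)/AE//|].
case: h => [[v Pv Av]|[e1 [e2 [e3 [tr Te Ae]]]]].
  by left; exists v => // e /(fintype.subsetP BA); exact: Av.
have [Pa Pb Pc] := PT Te; move: (tr) => /and3P[/eqP h1 /eqP h2 /eqP h3].
have [e1B|e1B] := boolP (e1 \in B); last first.
  left; exists (rgt e2) => // e eB; have := fintype.subsetP BA _ eB.
  rewrite Ae !inE -orbA => /or3P[] /eqP ee; rewrite ee /inc ?h3 ?eqxx ?orbT //.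
  by rewrite -ee eB in e1B.
have [e2B|e2B] := boolP (e2 \in B); last first.
  left; exists (lft e1) => // e eB; have := fintype.subsetP BA _ eB.
  rewrite Ae !inE -orbA => /or3P[] /eqP ee; rewrite ee /inc ?h1 ?eqxx ?orbT //.
  by rewrite -ee eB in e2B.
have [e3B|e3B] := boolP (e3 \in B); last first.
  left; exists (rgt e1) => // e eB; have := fintype.subsetP BA _ eB.
  rewrite Ae !inE -orbA => /or3P[] /eqP ee; rewrite ee /inc ?h2 ?eqxx ?orbT //.
  by rewrite -ee eB in e3B.
right; exists e1, e2, e3; split=> //; rewrite -Ae.
apply/eqP; rewrite finset.eqEsubset BA Ae; apply/fintype.subsetP => e.
by rewrite !inE -orbA => /or3P[] /eqP ->.
Qed.

(** Distinct chords share at most one end. A face with [e] and another chord [u] therefore lies in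
    the star at their common end, where [f] or [g] serves as apex, or is a triangle. Any remaining
    triangle at [e] is contained in {e, f, g}, so it does not involve a chord [u] outside that
    set. *)
Lemma chord_complex_strip (R : realType) (r : V -> nat) (top : nat) :
  (forall e, E e -> (r e < top)%N -> exists f g,
    [/\ E f /\ E g, (r e < r f)%N /\ (r e < r g)%N, K [set e; f; g]%SET,
      forall v u, P v -> inc v e -> inc v u -> u != e -> E u ->
        (r e <= r u)%N -> inc v f || inc v g &
      forall e1 e2 e3, triangle e1 e2 e3 -> T (lft e1) (rgt e1) (rgt e2) ->
        (r e <= r e1)%N -> (r e <= r e2)%N -> (r e <= r e3)%N ->
        e \in [set e1; e2; e3]%SET ->
        [set e1; e2; e3]%SET \subset [set e; f; g]%SET]) ->
  homotopy_equivalent R (geom R K)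
    (geom R (chord_complex (fun e => E e && (top <= r e)%N) P T)).
Proof.
move=> step.
have <- : geom R (fun A => K A /\ forall e, e \in A -> (top <= r e)%N) =
    geom R (chord_complex (fun e => E e && (top <= r e)%N) P T).
  apply: geom_ext => A; split=> [[[AE h] At]|[AE h]].
    by split=> // e eA; rewrite AE ?At.
  by split; [split=> // e /AE/andP[]|move=> e /AE/andP[]].
apply: homotopy_equivalent_strip; first exact: chord_complex_down.
move=> e et [Ee _]; have {}Ee : E e by apply: Ee; rewrite inE.
have [f [g [[Ef Eg] [ef eg] Kefg star tri]]] := step e Ee et.
exists f, g; split=> // u; rewrite !inE !negb_or => /andP[/andP[ue uf] ug].
have cone v h : P v -> E h -> inc v h ->
    (forall w, P w -> inc w e -> inc w u -> w = v) ->
    forall A : {set V}, K A -> (forall a, a \in A -> (r e <= r a)%N) ->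
    e \in A -> u \in A -> K (h |: A).
  move=> Pv Eh vh v_uniq A [AE AK] Ar eA uA.
  case: AK => [[w Pw Aw]|[e1 [e2 [e3 [tr Te Ae]]]]].
    apply: (@chord_complex_star _ v) => // a.
    have wv : w = v by apply: v_uniq => //; exact: Aw.
    by rewrite !inE => /orP[/eqP->|aA]; [rewrite Eh|rewrite AE //= -wv Aw].
  have sub : [set e1; e2; e3]%SET \subset [set e; f; g]%SET.
    by apply: tri => //; rewrite -?Ae //; apply: Ar; rewrite Ae !inE eqxx ?orbT.
  have := fintype.subsetP sub u; rewrite -Ae uA => /(_ isT).
  by rewrite !inE (negbTE ue) (negbTE uf) (negbTE ug).
have [[v [Pv ve vu] ]|nv] := pselect (exists v, [/\ P v, inc v e & inc v u]); last first.
  left=> A [AE [[v Pv Av]|[e1 [e2 [e3 [tr Te Ae]]]]]] Ar eA uA.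
    by case: nv; exists v; rewrite !Av.
  have sub : [set e1; e2; e3]%SET \subset [set e; f; g]%SET.
    by apply: tri => //; rewrite -?Ae //; apply: Ar; rewrite Ae !inE eqxx ?orbT.
  have := fintype.subsetP sub u; rewrite -Ae uA => /(_ isT).
  by rewrite !inE (negbTE ue) (negbTE uf) (negbTE ug).
have uniq w : inc w e -> inc w u -> w = v.
  move=> we wu; apply/eqP; apply: contraNT ue => wv; apply/eqP.
  exact: (inc_inj wv).
have [Eu_r|nEu] := pselect (E u /\ (r e <= r u)%N); last first.
  by left=> A [AE _] Ar eA uA; case: nEu; split; [exact: AE|exact: Ar].
have := star v u Pv ve vu ue Eu_r.1 Eu_r.2.
by case/orP=> vh; [left|right]; apply: (cone v) => // w _; exact: uniq.
Qed.

End complex.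

(** If the pairwise meeting chords have no common end, fix [e1] with ends x and y, some [e2] missing
    x and some [e3] missing y. These two meet at a third point z, and any further chord must meet
    all three sides, hence contains two of x, y, z and is a side itself. *)
Lemma intersecting_chords (A : {set V}) :
  (forall e e', e \in A -> e' \in A -> e != e' -> inc (lft e) e' || inc (rgt e) e')
  <-> chord_complex xpredT xpredT (fun _ _ => xpredT) A.
Proof.
have meet e e' v : inc v e -> inc v e' -> inc (lft e) e' || inc (rgt e) e'.
  by rewrite /inc => /orP[] /eqP <- ->; rewrite ?orbT.
split=> [Ai|[_ [[v _ Av]|[e1 [e2 [e3 [tr _ ->]]]]]]]; last 2 first.
- by move=> e e' eA e'A _; apply: (@meet _ _ v); exact: Av.
- move: tr; rewrite /triangle => /and3P[/eqP h1 /eqP h2 /eqP h3] e e'.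
  rewrite !inE /inc -!orbA => /or3P[] /eqP -> /or3P[] /eqP ->;
  by rewrite ?h1 ?h2 ?h3 ?eqxx ?orbT.
split=> //.
have [->|/set0Pn[e1 e1A]] := eqVneq A finset.set0.
  by left; exists 0%N => // e; rewrite inE.
have [/forall_inP lo1|] := boolP [forall e in A, inc (lft e1) e].
  by left; exists (lft e1).
have [/forall_inP hi1|] := boolP [forall e in A, inc (rgt e1) e].
  by left; exists (rgt e1).
case/forall_inPn => e3 e3A n3; case/forall_inPn => e2 e2A n2; right.
have m12 : inc (lft e1) e2 || inc (rgt e1) e2.
  by apply: Ai => //; apply: contraNneq n2 => <-; rewrite /inc eqxx.
have m13 : inc (lft e1) e3 || inc (rgt e1) e3.
  by apply: Ai => //; apply: contraNneq n3 => <-; rewrite /inc eqxx orbT.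
have n23 : e2 != e3.
  by apply: contraNneq n3 => <-; move: m12; rewrite (negbTE n2).
have m23 := Ai _ _ e2A e3A n23.
have share a b : inc (lft a) b || inc (rgt a) b ->
    exists2 v, inc v a & inc v b.
  by case/orP=> ?; [exists (lft a)|exists (rgt a)]; rewrite // /inc eqxx ?orbT.
have x1 : inc (lft e1) e1 by rewrite /inc eqxx.
have y1 : inc (rgt e1) e1 by rewrite /inc eqxx orbT.
have xy : lft e1 != rgt e1 by rewrite ltn_eqF.
have y2 : inc (rgt e1) e2 by move: m12; rewrite (negbTE n2).
have x3 : inc (lft e1) e3 by move: m13; rewrite (negbTE n3) orbF.
have [z z2 z3] := share _ _ m23.
have xz : lft e1 != z by apply: contraNneq n2 => ->.
have yz : rgt e1 != z by apply: contraNneq n3 => ->.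
have meets e e' a b : e \in A -> e' \in A -> e != e' -> a != b ->
    inc a e' -> inc b e' -> inc a e \/ inc b e.
  move=> eA e'A ee' ab ae be; have [v ve ve'] := share _ _ (Ai _ _ eA e'A ee').
  by have [va|vb] := inc_two ab ae be ve'; [left; rewrite -va|right; rewrite -vb].
have all3 e : e \in A -> e \in [set e1; e2; e3]%SET.
  move=> eA; apply: contraT; rewrite !inE !negb_or => /andP[/andP[d1 d2] d3].
  have [xe|ye] := meets _ _ _ _ eA e1A d1 xy x1 y1.
    have [ye|ze] := meets _ _ _ _ eA e2A d2 yz y2 z2.
      by rewrite (inc_inj xy xe ye x1 y1) eqxx in d1.
    by rewrite (inc_inj xz xe ze x3 z3) eqxx in d3.
  have [xe|ze] := meets _ _ _ _ eA e3A d3 xz x3 z3.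
    by rewrite (inc_inj xy xe ye x1 y1) eqxx in d1.
  by rewrite (inc_inj yz ye ze y2 z2) eqxx in d2.
have AE : A = [set e1; e2; e3]%SET.
  apply/eqP; rewrite finset.eqEsubset; apply/andP; split.
    exact/fintype.subsetP.
  by apply/fintype.subsetP => e; rewrite !inE -orbA => /or3P[] /eqP ->.
have perm a b c : [set a; b; c]%SET = [set e1; e2; e3]%SET -> triangle a b c ->
    exists e1 e2 e3, [/\ triangle e1 e2 e3, true & A = [set e1; e2; e3]%SET].
  by move=> s t; exists a, b, c; rewrite s.
have s312 : [set e3; e1; e2]%SET = [set e1; e2; e3]%SET.
  by apply/finset.setP => e; rewrite !inE; do 3!case: (e == _).
have s321 : [set e3; e2; e1]%SET = [set e1; e2; e3]%SET.
  by apply/finset.setP => e; rewrite !inE; do 3!case: (e == _).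
(* The position of z relative to the ends of [e1] decides the order in which [triangle] lists the
   sides. *)
have [zx|xz'] := ltnP z (lft e1).
  have [l3 r3] := inc_lt zx z3 x3.
  have [l2 r2] := inc_lt (ltn_trans zx (lft_rgt e1)) z2 y2.
  by apply: (perm e3 e1 e2) => //; rewrite /triangle l3 r3 l2 r2 !eqxx.
have {}xz' : (lft e1 < z)%N by rewrite ltn_neqAle xz.
have [l3 r3] := inc_lt xz' x3 z3.
have [zy|yz'] := ltnP z (rgt e1).
  have [l2 r2] := inc_lt zy z2 y2.
  by apply: (perm e3 e2 e1) => //; rewrite /triangle l3 r3 l2 r2 !eqxx.
have {}yz' : (rgt e1 < z)%N by rewrite ltn_neqAle yz.
have [l2 r2] := inc_lt yz' y2 z2.
by apply: (perm e1 e2 e3) => //; rewrite /triangle l3 r3 l2 r2 !eqxx.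
Qed.

End chords.

(** * Vertices of the stable Kneser graph as chords of a cycle *)

(** From here on only the ends of a chord matter, numbered from 0 to [m - 1]; [chord_wrap] excludes
    the cycle edge {0, m-1}. *)
Record cycle_chords (m : nat) (V : finType) (lft rgt : V -> nat) : Prop := {
  chord_gap : forall e, (lft e + 2 <= rgt e)%N;
  chord_bound : forall e, (rgt e < m)%N;
  chord_wrap : forall e, (0 < lft e)%N || ((rgt e).+1 < m)%N;
  chord_ext : forall e e', lft e = lft e' -> rgt e = rgt e' -> e = e';
  chord_ex : forall a b, (a + 2 <= b)%N -> (b < m)%N ->
    (0 < a)%N || (b.+1 < m)%N -> exists e, lft e = a /\ rgt e = b }.

Lemma SG_vertex_ends k (e : SG_vertex 2 k) : exists p : nat * nat,
  [/\ (p.1 + 2 <= p.2)%N, (p.2 < k + 4)%N, (0 < p.1)%N || (p.2.+1 < k + 4)%N &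
    forall v : 'I_(2 * 2 + k), (v \in val e) = (v == p.1 :> nat) || (v == p.2 :> nat)].
Proof.
have /andP[/cards2P[x [y [xy exy]]] st] := valP e.
have main (a b : 'I_(2 * 2 + k)) : val e = [set a; b]%SET -> (a < b)%N ->
    exists p : nat * nat,
  [/\ (p.1 + 2 <= p.2)%N, (p.2 < k + 4)%N, (0 < p.1)%N || (p.2.+1 < k + 4)%N &
    forall v : 'I_(2 * 2 + k), (v \in val e) = (v == p.1 :> nat) || (v == p.2 :> nat)].
  move=> eab ab; exists (val a, val b) => /=.
  have := forallP (forallP st a) b; rewrite -eab fintype.subxx implybF.
  rewrite /forbidden_pair negb_or => /andP[n1 n2].
  have bb := ltn_ord b.
  split=> [|||v]; last by rewrite eab !inE.
  - by move: n1 ab; lia.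
  - by move: bb; lia.
  - by move: n2 bb; lia.
case: (ssrnat.ltngtP x y) => xy'.
- exact: main exy xy'.
- by apply: (main y x) => //; rewrite exy finset.setUC.
- by move/eqP: xy; case; exact: val_inj.
Qed.

Lemma SG_chords k : exists lft rgt : SG_vertex 2 k -> nat,
  cycle_chords (k + 4) lft rgt /\
  (forall e e', SG e e' = ~~ (inc lft rgt (lft e) e' || inc lft rgt (rgt e) e')).
Proof.
have [p pP] := choice (@SG_vertex_ends k).
have mE : (2 * 2 + k = k + 4)%N by rewrite addnC.
exists (fun e => (p e).1), (fun e => (p e).2); split; [split|].
- by move=> e; have [] := pP e.
- by move=> e; have [] := pP e.
- by move=> e; have [] := pP e.
- move=> e e' l r; apply: val_inj; apply/finset.setP => v.
  by have [_ _ _ ->] := pP e; have [_ _ _ ->] := pP e'; rewrite l r.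
- move=> a b ab bm w.
  have am' : (a < 2 * 2 + k)%N by lia.
  have bm' : (b < 2 * 2 + k)%N by lia.
  pose x := Ordinal am'; pose y := Ordinal bm'.
  have card2 : #|[set x; y]%SET| == 2.
    by rewrite cards2; have -> : x != y by rewrite -val_eqE /=; lia.
  have st : stable [set x; y]%SET.
    apply/forallP => i; apply/forallP => j; apply/implyP => fij.
    apply/negP; rewrite finset.subUset !finset.sub1set !inE -!val_eqE /=.
    by move: fij; rewrite /forbidden_pair; move: (ltn_ord j) (ltn_ord i); lia.
  have exy : (#|[set x; y]%SET| == 2) && stable [set x; y]%SET by rewrite card2.
  exists (exist _ [set x; y]%SET exy).
  have [/= h1 h2 _ h] := pP (exist _ [set x; y]%SET exy).
  set q := p _ in h1 h2 h *.
  have hx := h x; have hy := h y; rewrite !inE !eqxx ?orbT /= in hx hy.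
  by move: hx hy; lia.
move=> e e'; have [h1 h2 _ h] := pP e; have [h1' h2' _ h'] := pP e'.
have lm : ((p e).1 < 2 * 2 + k)%N by lia.
have rm : ((p e).2 < 2 * 2 + k)%N by lia.
rewrite /SG; apply/eqP/idP => [e0|].
  apply/negP; rewrite /inc => /orP[] ee'.
  - have := finset.in_set0 (Ordinal lm); rewrite -e0 inE h h' /=.
    by rewrite eqxx ee'.
  - have := finset.in_set0 (Ordinal rm); rewrite -e0 inE h h' /=.
    by rewrite eqxx orbT ee'.
move=> n; apply/finset.setP => v; rewrite !inE h h'.
by apply: contraNF n => /andP[/orP[] /eqP vp]; rewrite vp /inc => ->; rewrite ?orbT.
Qed.

Lemma realization_SG (R : realType) k lft rgt :
  @cycle_chords (k + 4) (SG_vertex 2 k) lft rgt ->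
  (forall e e', SG e e' = ~~ (inc lft rgt (lft e) e' || inc lft rgt (rgt e) e')) ->
  realization R (Ind (@SG 2 k)) =
  geom R (chord_complex lft rgt xpredT xpredT (fun _ _ => xpredT)).
Proof.
move=> cc SGE.
have -> : realization R (Ind (@SG 2 k)) =
  geom R (fun A : {set SG_vertex 2 k} => A \in (Ind (@SG 2 k) : {set {set _}})) by [].
have lr e : (lft e < rgt e)%N by have := chord_gap cc e; lia.
apply: geom_ext => A.
rewrite -(intersecting_chords lr (chord_ext cc)) /Ind /= inE /independent; split.
  move=> /forall_inP h e e' eA e'A ee'; have /forall_inP := h e eA.
  by move/(_ e' e'A); rewrite ee' SGE negbK.
move=> h; apply/forall_inP => e eA; apply/forall_inP => e' e'A; apply/implyP => ee'.
by rewrite SGE negbK; exact: h.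
Qed.

Local Open Scope nat_scope.

Section triangles.
Variables (V : finType) (lft rgt : V -> nat).
Hypothesis lft_rgt : forall e, (lft e < rgt e)%N.

Lemma triangle_inj e1 e2 e3 f1 f2 f3 :
  triangle lft rgt e1 e2 e3 -> triangle lft rgt f1 f2 f3 ->
  [set e1; e2; e3]%SET = [set f1; f2; f3]%SET -> [/\ e1 = f1, e2 = f2 & e3 = f3].
Proof.
move=> /and3P[/eqP a1 /eqP a2 /eqP a3] /and3P[/eqP b1 /eqP b2 /eqP b3] ef.
have l1 := lft_rgt e1; have l2 := lft_rgt e2; have l3 := lft_rgt e3.
have m1 : e1 \in [set f1; f2; f3]%SET by rewrite -ef !inE eqxx.
have m2 : e2 \in [set f1; f2; f3]%SET by rewrite -ef !inE eqxx orbT.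
have m3 : e3 \in [set f1; f2; f3]%SET by rewrite -ef !inE eqxx orbT.
move: m1 m2 m3; rewrite !inE -!orbA.
case/or3P=> /eqP m1; case/or3P=> /eqP m2; case/or3P=> /eqP m3;
  by [split|exfalso; move: a1 a2 a3 b1 b2 b3 l1 l2 l3; rewrite m1 m2 m3; lia].
Qed.

Lemma triangle_split e1 e2 e3 e : triangle lft rgt e1 e2 e3 ->
  e \in [set e1; e2; e3]%SET -> exists f g,
  [/\ [set e; f; g]%SET = [set e1; e2; e3]%SET, e != f, e != g &
    forall v, inc lft rgt v e -> inc lft rgt v f || inc lft rgt v g].
Proof.
move=> /and3P[/eqP h1 /eqP h2 /eqP h3].
have l1 := lft_rgt e1; have l2 := lft_rgt e2; have l3 := lft_rgt e3.
have e12 : e1 != e2 by apply: contraTneq l1 => e12; rewrite -h2 e12 ltnn.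
have e23 : e2 != e3 by apply/eqP => e23; move: h1 h2 l1; rewrite -e23; lia.
have e13 : e1 != e3 by apply/eqP => e13; move: h2 h3 l2; rewrite -e13; lia.
rewrite !inE -orbA => /or3P[] /eqP ->.
- exists e2, e3; split=> // v.
  by rewrite /inc h1 h2 => /orP[] ->; rewrite ?orbT.
- exists e1, e3; split=> //; last 2 first.
  + by rewrite eq_sym.
  + by move=> v; rewrite /inc h2 h3 => /orP[] ->; rewrite ?orbT.
  by apply/finset.setP => x; rewrite !inE; do 3!case: (x == _).
- exists e1, e2; split; last 3 first.
  + by rewrite eq_sym.
  + by rewrite eq_sym.
  + by move=> v; rewrite /inc h1 h3 => /orP[] ->; rewrite ?orbT.
  by apply/finset.setP => x; rewrite !inE; do 3!case: (x == _).
Qed.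

End triangles.

Lemma cycle_lft_rgt m (V : finType) (lft rgt : V -> nat) e :
  cycle_chords m lft rgt -> lft e < rgt e.
Proof. by move=> cc; have := chord_gap cc e; lia. Qed.

(** * Cycles with at least eight vertices *)

Section large.
Variables (m : nat) (V : finType) (lft rgt : V -> nat).
Hypotheses (m_ge8 : (8 <= m)%N) (cc : cycle_chords m lft rgt).

(* A collapsing scheme for the 2-skeleton of the independence complex of the
   cycle on [0, ..., m - 1]: edges are removed by increasing rank, each through
   the triangle with the vertex [apex] or, from rank 5 on, as a leaf. *)
Definition rank (a b : nat) : nat :=
  if a == 0 then (if b == 2 then 7 else 6)
  else if a == 1 then (if b == 3 then 5 else if b == 4 then 0 else 1)
  else if b.+1 == m then (if a == 2 then 5 else if a == 3 then 2 else 3)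
  else 4.

(** The listed triangles and the sides removed through them are: {0, b, c} with {b, c}; {1, 3, c}
    with {1, c}; {1, 4, 6} with {1, 4}; {2, b, m-1} with {b, m-1}; {3, 5, m-1} with {3, m-1}. The
    two single triangles are there because 3 is adjacent to 4 and to 2, so {1, 4} cannot use the
    vertex 3 nor {3, m-1} the vertex 2. The last triangle needs [5 + 2 <= m - 1], that is
    [m >= 8]. *)
Definition collapsible_triangle (a b c : nat) : bool :=
  [|| a == 0, (a == 1) && (b == 3), [&& a == 1, b == 4 & c == 6],
      (a == 2) && (c.+1 == m) | [&& a == 3, b == 5 & c.+1 == m]].

Definition cycle_rank e := rank (lft e) (rgt e).
Local Notation r := cycle_rank.

(** The table of ranks, as a disjunction of linear conditions that [lia] can use. *)
Lemma cycle_rankP e :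
  (lft e = 0 /\ rgt e = 2 /\ r e = 7) \/
  (lft e = 0 /\ rgt e > 2 /\ rgt e + 2 <= m /\ r e = 6) \/
  (lft e = 1 /\ rgt e = 3 /\ r e = 5) \/
  (lft e = 1 /\ rgt e = 4 /\ r e = 0) \/
  (lft e = 1 /\ rgt e > 4 /\ r e = 1) \/
  (lft e = 2 /\ rgt e + 1 = m /\ r e = 5) \/
  (lft e = 3 /\ rgt e + 1 = m /\ r e = 2) \/
  (lft e > 3 /\ rgt e + 1 = m /\ r e = 3) \/
  (lft e > 1 /\ rgt e + 2 <= m /\ r e = 4).
Proof.
have := chord_gap cc e; have := chord_bound cc e; have := chord_wrap cc e.
rewrite /cycle_rank /rank; case: eqP => [->|a0]; first by case: eqP; lia.
case: eqP => [->|a1]; first by case: eqP => [->|b3]; [lia|case: eqP; lia].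
case: eqP => bm; last by lia.
by case: eqP => a2; [lia|case: eqP; lia].
Qed.

(** This is the pairing of each listed triangle with its lowest side. Strictness keeps the other two
    sides available when that side is removed, and tree chords, of rank at least 5, are never
    lowest. *)
Lemma triangle_min e1 e2 e3 : triangle lft rgt e1 e2 e3 ->
  collapsible_triangle (lft e1) (rgt e1) (rgt e2) ->
  [\/ [/\ lft e1 = 0, r e2 = 4, r e2 < r e1 & r e2 < r e3],
      [/\ rgt e1 = 3, r e3 = 1, r e3 < r e1 & r e3 < r e2],
      [/\ rgt e2 = 6, r e1 = 0, r e1 < r e2 & r e1 < r e3] |
      [/\ lft e1 = 2, r e2 = 3, r e2 < r e1 & r e2 < r e3] \/
      [/\ rgt e1 = 5, r e3 = 2, r e3 < r e1 & r e3 < r e2]].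
Proof.
move=> /and3P[/eqP h1 /eqP h2 /eqP h3].
have g1 := chord_gap cc e1; have g2 := chord_gap cc e2; have g3 := chord_gap cc e3.
have b2 := chord_bound cc e2.
have p1 := cycle_rankP e1; have p2 := cycle_rankP e2; have p3 := cycle_rankP e3.
have w3 := chord_wrap cc e3.
case/or4P=> [/eqP a0|/andP[/eqP a1 /eqP b]|/and3P[/eqP a1 /eqP b /eqP c]|].
- by apply: Or41; split; lia.
- by apply: Or42; split; lia.
- by apply: Or43; split; lia.
case/orP=> [/andP[/eqP a /eqP c]|/and3P[/eqP a /eqP b /eqP c]].
- by apply: Or44; left; split; lia.
- by apply: Or44; right; split; lia.
Qed.

End large.

Section large_collapse.
Variables (m : nat) (V : finType) (lft rgt : V -> nat).
Hypotheses (m_ge8 : (8 <= m)%N) (cc : cycle_chords m lft rgt).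

Local Notation r := (cycle_rank m lft rgt).
Local Notation K := (chord_complex lft rgt xpredT xpredT (collapsible_triangle m)).

Lemma strict_min_unique (A : {set V}) e x y z : A = [set x; y; z]%SET ->
  e \in A -> r x < r y -> r x < r z -> r e <= r x ->
  (forall f, f \in A -> e != f -> r e < r f) /\ e = x.
Proof.
move=> ->; rewrite !inE -orbA => e_in xy xz ex.
have -> : e = x.
  case/or3P: e_in ex => /eqP -> //.
  - by rewrite leqNgt xy.
  - by rewrite leqNgt xz.
split=> // f; rewrite !inE -orbA => /or3P[] /eqP -> //.
by rewrite eqxx.
Qed.

Lemma triangle_min_edge e1 e2 e3 e : triangle lft rgt e1 e2 e3 ->
  collapsible_triangle m (lft e1) (rgt e1) (rgt e2) ->
  e \in [set e1; e2; e3]%SET -> r e <= r e1 -> r e <= r e2 -> r e <= r e3 ->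
  (forall f, f \in [set e1; e2; e3]%SET -> e != f -> r e < r f) /\
  [\/ [/\ e = e2, r e = 4 & lft e1 = 0], [/\ e = e3, r e = 1 & rgt e1 = 3],
      [/\ e = e1, r e = 0 & rgt e2 = 6] |
      [/\ e = e2, r e = 3 & lft e1 = 2] \/ [/\ e = e3, r e = 2 & rgt e1 = 5]].
Proof.
move=> tr Te e_in m1 m2 m3.
have p213 : [set e1; e2; e3]%SET = [set e2; e1; e3]%SET.
  by apply/finset.setP => x; rewrite !inE; do 3!case: (x == _).
have p312 : [set e1; e2; e3]%SET = [set e3; e1; e2]%SET.
  by apply/finset.setP => x; rewrite !inE; do 3!case: (x == _).
have [[h k l n]|[h k l n]|[h k l n]|[[h k l n]|[h k l n]]] :=
  triangle_min m_ge8 cc tr Te.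
- have [st ee] := strict_min_unique p213 e_in l n m2.
  by split=> //; apply: Or41; rewrite ee.
- have [st ee] := strict_min_unique p312 e_in l n m3.
  by split=> //; apply: Or42; rewrite ee.
- have [st ee] := strict_min_unique erefl e_in l n m1.
  by split=> //; apply: Or43; rewrite ee.
- have [st ee] := strict_min_unique p213 e_in l n m2.
  by split=> //; apply: Or44; left; rewrite ee.
- have [st ee] := strict_min_unique p312 e_in l n m3.
  by split=> //; apply: Or44; right; rewrite ee.
Qed.

(** The rank of the lowest side tells the family of the triangle; that side and the fixed vertex of
    the family (0, 3, 6, 2 or 5) determine the triangle. *)
Lemma triangle_min_unique e1 e2 e3 f1 f2 f3 e :
  triangle lft rgt e1 e2 e3 -> triangle lft rgt f1 f2 f3 ->
  collapsible_triangle m (lft e1) (rgt e1) (rgt e2) ->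
  collapsible_triangle m (lft f1) (rgt f1) (rgt f2) ->
  e \in [set e1; e2; e3]%SET -> e \in [set f1; f2; f3]%SET ->
  r e <= r e1 -> r e <= r e2 -> r e <= r e3 ->
  r e <= r f1 -> r e <= r f2 -> r e <= r f3 ->
  [set e1; e2; e3]%SET = [set f1; f2; f3]%SET.
Proof.
move=> te tf Te Tf ee ef r1 r2 r3 s1 s2 s3.
have ext := chord_ext cc.
have [_] := triangle_min_edge tf Tf ef s1 s2 s3.
have [_] := triangle_min_edge te Te ee r1 r2 r3.
move: te tf => /and3P[/eqP a1 /eqP a2 /eqP a3] /and3P[/eqP b1 /eqP b2 /eqP b3].
case=> [[x y z]|[x y z]|[x y z]|[[x y z]|[x y z]]];
case=> [[x' y' z']|[x' y' z']|[x' y' z']|[[x' y' z']|[x' y' z']]];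
  try (by move: y'; rewrite y);
  move: a1 a2 a3 b1 b2 b3 z z'; rewrite -x -x' => a1 a2 a3 b1 b2 b3 z z'.
- have -> : e1 = f1 by apply: ext; congruence.
  by have -> : e3 = f3 by apply: ext; congruence.
- have -> : e1 = f1 by apply: ext; congruence.
  by have -> : e2 = f2 by apply: ext; congruence.
- have -> : e2 = f2 by apply: ext; congruence.
  by have -> : e3 = f3 by apply: ext; congruence.
- have -> : e1 = f1 by apply: ext; congruence.
  by have -> : e3 = f3 by apply: ext; congruence.
- have -> : e1 = f1 by apply: ext; congruence.
  by have -> : e2 = f2 by apply: ext; congruence.
Qed.

(** The condition of [chord_complex_strip] for a single chord, with [E] and [P] everywhere true; the
    trivial conjuncts keep its exact shape. *)
Definition removable e f g :=
  [/\ true /\ true, (r e < r f)%N /\ (r e < r g)%N, K [set e; f; g]%SET,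
    forall v u, xpredT v -> inc lft rgt v e -> inc lft rgt v u -> u != e ->
      true -> (r e <= r u)%N -> inc lft rgt v f || inc lft rgt v g &
    forall e1 e2 e3, triangle lft rgt e1 e2 e3 ->
      collapsible_triangle m (lft e1) (rgt e1) (rgt e2) ->
      (r e <= r e1)%N -> (r e <= r e2)%N -> (r e <= r e3)%N ->
      e \in [set e1; e2; e3]%SET ->
      [set e1; e2; e3]%SET \subset [set e; f; g]%SET].

Lemma removable_triangle e1 e2 e3 e : triangle lft rgt e1 e2 e3 ->
  collapsible_triangle m (lft e1) (rgt e1) (rgt e2) ->
  e \in [set e1; e2; e3]%SET -> r e <= r e1 -> r e <= r e2 -> r e <= r e3 ->
  exists f g, removable e f g.
Proof.
move=> tr Te e_in r1 r2 r3.
have [f [g [sE ef eg star]]] :=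
  triangle_split (fun e => cycle_lft_rgt e cc) tr e_in.
have lt h : h \in [set e; f; g]%SET -> e != h -> r e < r h.
  by have [st _] := triangle_min_edge tr Te e_in r1 r2 r3; rewrite sE; exact: st.
exists f, g; split=> //.
- by split; apply: lt; rewrite // !inE eqxx ?orbT.
- by split=> //; right; exists e1, e2, e3.
- by move=> v u _ ve _ _ _ _; exact: star.
move=> f1 f2 f3 tf Tf s1 s2 s3 ef'; rewrite sE.
by rewrite (@triangle_min_unique e1 e2 e3 f1 f2 f3 e).
Qed.

Lemma removable_through a b c e : collapsible_triangle m a b c ->
  a + 2 <= b -> b + 2 <= c -> c < m -> (0 < a) || (c.+1 < m) ->
  [\/ lft e = a /\ rgt e = b, lft e = b /\ rgt e = c | lft e = a /\ rgt e = c] ->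
  r e <= rank m a b -> r e <= rank m b c -> r e <= rank m a c ->
  exists f g, removable e f g.
Proof.
move=> Tabc ab bc cm w e_in rab rbc rac.
have [e1 [l1 r1]] : exists e, lft e = a /\ rgt e = b by apply: (chord_ex cc); lia.
have [e2 [l2 r2]] : exists e, lft e = b /\ rgt e = c by apply: (chord_ex cc); lia.
have [e3 [l3 r3]] : exists e, lft e = a /\ rgt e = c by apply: (chord_ex cc); lia.
apply: (@removable_triangle e1 e2 e3).
- by rewrite /triangle l1 l2 l3 r1 r2 r3 !eqxx.
- by rewrite l1 r1 r2.
- case: e_in => -[le re]; rewrite !inE.
  + have -> : e = e1 by apply: (chord_ext cc); congruence.
    by rewrite eqxx.
  + have -> : e = e2 by apply: (chord_ext cc); congruence.
    by rewrite eqxx orbT.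
  + have -> : e = e3 by apply: (chord_ext cc); congruence.
    by rewrite eqxx orbT.
- by rewrite /cycle_rank l1 r1 -/(cycle_rank m lft rgt e).
- by rewrite /cycle_rank l2 r2 -/(cycle_rank m lft rgt e).
- by rewrite /cycle_rank l3 r3 -/(cycle_rank m lft rgt e).
Qed.

(** Here [x] is the free end, and [f] dominates [e] through the other end [y]. Rank above 4 prevents
    [e] from being the lowest side of a listed triangle. *)
Lemma removable_leaf e f x y : inc lft rgt x e -> inc lft rgt y e -> x != y ->
  inc lft rgt y f -> r e < r f -> 4 < r e ->
  (forall u, inc lft rgt x u -> r e <= r u -> u = e) ->
  removable e f f.
Proof.
move=> xe ye xy yf ef e4 leaf; split=> //.
- apply: (@chord_complex_star _ _ _ _ _ _ _ y) => // a.
  by rewrite !inE -orbA => /or3P[] /eqP ->.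
- move=> v u _ ve vu ue _ eu.
  have [vx|->] := inc_two xy xe ye ve; last by rewrite yf.
  by move: ue; rewrite (leaf u) ?eqxx // -vx.
move=> e1 e2 e3 tr Te r1 r2 r3 e_in.
have [_ [[_ re _]|[_ re _]|[_ re _]|[[_ re _]|[_ re _]]]] :=
  triangle_min_edge tr Te e_in r1 r2 r3; by move: e4; rewrite re.
Qed.

(** Below rank 5 the paired triangle is used. Then the tree is pruned: {1, 3} is absorbed by {0, 3}
    and {2, m-1} by {0, 2}, after which the other chords at 0 are absorbed by {0, 2}, the only chord
    of rank 7. *)
Lemma removable_edge e : r e < 7 -> exists f g, removable e f g.
Proof.
move=> re.
have ex a b := @chord_ex _ _ _ _ cc a b.
have gap := chord_gap cc e; have bd := chord_bound cc e; have wr := chord_wrap cc e.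
have xe : inc lft rgt (lft e) e by rewrite /inc eqxx.
have ye : inc lft rgt (rgt e) e by rewrite /inc eqxx orbT.
have xy : lft e != rgt e by rewrite ltn_eqF // (cycle_lft_rgt e cc).
have yx : rgt e != lft e by rewrite eq_sym.
have rankE f a b : lft f = a -> rgt f = b -> r f = rank m a b.
  by move=> fa fb; rewrite /cycle_rank fa fb.
have [f02 [f02l f02r]] : exists e, lft e = 0 /\ rgt e = 2 by apply: ex; lia.
have r02 : r f02 = 7 by rewrite (rankE _ _ _ f02l f02r).
have [f03 [f03l f03r]] : exists e, lft e = 0 /\ rgt e = 3 by apply: ex; lia.
have r03 : r f03 = 6 by rewrite (rankE _ _ _ f03l f03r).
have := cycle_rankP m_ge8 cc e.
case=> [[_ [_ r7]]|]; first by move: re; rewrite r7.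
case=> [[l0 [r2 [rm r6]]]|].
  exists f02, f02; apply: (removable_leaf ye xe yx); rewrite ?r02 ?r6 //.
    by rewrite /inc l0 f02l eqxx.
  move=> u yu ru; apply: (chord_ext cc);
    by have := cycle_rankP m_ge8 cc u; move: yu; rewrite /inc; lia.
case=> [[l1 [r3 r5]]|].
  exists f03, f03; apply: (removable_leaf xe ye xy); rewrite ?r03 ?r5 //.
    by rewrite /inc r3 f03r eqxx orbT.
  have gap' := chord_gap cc.
  move=> u yu ru; apply: (chord_ext cc);
    by have := cycle_rankP m_ge8 cc u; move: yu (gap' u); rewrite /inc; lia.
case=> [[l1 [r4 r0]]|].
  apply: (@removable_through 1 4 6); rewrite ?r0 //; try lia.
  exact: Or31.
case=> [[l1 [r4 r1]]|].
  apply: (@removable_through 1 3 (rgt e)); rewrite ?r1 //; try lia.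
    exact: Or33.
  all: try by rewrite /rank /=; do ?case: ifP => //; lia.
case=> [[l2 [rm r5]]|].
  exists f02, f02; apply: (removable_leaf ye xe yx); rewrite ?r02 ?r5 //.
    by rewrite /inc l2 f02r eqxx orbT.
  move=> u yu ru; apply: (chord_ext cc);
    by have := cycle_rankP m_ge8 cc u; move: yu; rewrite /inc; lia.
case=> [[l3 [rm r2]]|].
  apply: (@removable_through 3 5 (rgt e)); rewrite ?r2 //; try lia.
  - by rewrite /collapsible_triangle /=; lia.
  - exact: Or33.
  all: try by rewrite /rank /=; do ?case: ifP => //; lia.
case=> [[l3 [rm r3]]|].
  apply: (@removable_through 2 (lft e) (rgt e)); rewrite ?r3 //; try lia.
  - by rewrite /collapsible_triangle /=; lia.
  - exact: Or32.
  - by rewrite /rank /=; do ?case: ifP => //; lia.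
  - by rewrite -r3.
  - by rewrite /rank /=; do ?case: ifP => //; lia.
case=> [l2 [rm r4]].
apply: (@removable_through 0 (lft e) (rgt e)); rewrite ?r4 //; try lia.
- exact: Or32.
- by rewrite /rank /=; do ?case: ifP => //; lia.
- by rewrite -r4.
- by rewrite /rank /=; do ?case: ifP => //; lia.
Qed.

Lemma collapsible_contractible (R : realType) :
  contractible R (geom R K).
Proof.
have lr e := cycle_lft_rgt e cc.
apply: (contractible_equivalent (@chord_complex_strip _ _ _ lr (chord_ext cc)
  xpredT xpredT (collapsible_triangle m) _ R r 7 _)) => //.
  by move=> e _ /removable_edge.
have [f [fl fr]] : exists e, lft e = 0 /\ rgt e = 2 by apply: (chord_ex cc); lia.
apply: (@point_contractible _ _ _ f) => [|A [A7 _]].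
  apply: (@chord_complex_star _ _ _ _ _ _ _ 0) => // e.
  by rewrite inE => /eqP ->; rewrite /inc /cycle_rank fl fr eqxx.
apply/fintype.subsetP => e /A7 /= re; rewrite inE; apply/eqP.
by apply: (chord_ext cc); have := cycle_rankP m_ge8 cc e; lia.
Qed.

End large_collapse.

Lemma card_sorted_triples n :
  #|[set x : 'I_n * 'I_n * 'I_n | x.1.1 < x.1.2 < x.2]%SET| = 'C(n, 3).
Proof.
rewrite -card_ltn_sorted_tuples.
pose f (x : 'I_n * 'I_n * 'I_n) : 3.-tuple 'I_n := [tuple x.1.1; x.1.2; x.2].
have f_inj : injective f by move=> [[a b] c] [[a' b'] c'] [-> -> ->].
rewrite -(card_imset _ f_inj); apply: eq_card => t; rewrite !inE.
apply/imsetP/idP => [[x + ->]|]; first by rewrite inE /= andbT.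
case/tupleP: t => a t; case/tupleP: t => b t; case/tupleP: t => c t.
rewrite (tuple0 t) /= andbT => abc; exists (a, b, c); first by rewrite inE.
exact: val_inj.
Qed.

(** * Counting the triangles that remain as cells *)

Section count.
Variable k : nat.
Hypothesis k_ge4 : 4 <= k.

(* The triple [u < v < w] in [0, ..., k] encodes the independent triple
   [u + 1, v + 2, w + 3] of the cycle on [0, ..., k + 3]. *)
Definition triple := ('I_k.+1 * 'I_k.+1 * 'I_k.+1)%type.

Definition sorted_triple (x : triple) : bool := x.1.1 < x.1.2 < x.2.

Definition collapsible_triple (x : triple) : bool :=
  collapsible_triangle (k + 4) (x.1.1 + 1) (x.1.2 + 2) (x.2 + 3).

Lemma card_collapsible_triples :
  #|[set x | sorted_triple x & collapsible_triple x]%SET| = 2 * k - 1.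
Proof.
(* Triangles at 0 are not encoded. The four branches list {1, 3, c} ([k - 1] of them), {1, 4, 6},
   {2, b, k+3} ([k - 2] of them) and {3, 5, k+3}. *)
pose h (i : nat) : nat * nat * nat :=
  if i < k - 1 then (0, 1, i + 2) else if i == k - 1 then (0, 2, 3)
  else if i < 2 * k - 2 then (1, i + 2 - k, k) else (2, 3, k).
pose f (i : 'I_(2 * k - 1)) : triple :=
  (inord (h i).1.1, inord (h i).1.2, inord (h i).2).
have hP (i : nat) : i < 2 * k - 1 ->
    [\/ i < k - 1 /\ h i = (0, 1, i + 2), i = k - 1 /\ h i = (0, 2, 3),
        (k <= i < 2 * k - 2) /\ h i = (1, i + 2 - k, k) |
        i = 2 * k - 2 /\ h i = (2, 3, k)].
  move=> ik; rewrite /h; case: ifP => i1; first by apply: Or41.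
  case: eqP => i2; first exact: Or42.
  case: ifP => i3; first by apply: Or43; split=> //; lia.
  by apply: Or44; split=> //; lia.
have fE (i : 'I_(2 * k - 1)) : ((f i).1.1 : nat, (f i).1.2 : nat, (f i).2 : nat) = h i.
  by rewrite /f; have [[l ->]|[l ->]|[l ->]|[l ->]] := hP i (ltn_ord i);
     rewrite /= ?inordK //; move: (ltn_ord i); lia.
have f_inj : injective f.
  move=> i j /(congr1 (fun x : triple => (x.1.1 : nat, x.1.2 : nat, x.2 : nat))).
  rewrite !fE => hij; apply: val_inj => /=.
  have [[l hi]|[l hi]|[l hi]|[l hi]] := hP i (ltn_ord i);
  have [[l' hj]|[l' hj]|[l' hj]|[l' hj]] := hP j (ltn_ord j);
  by move: hij; rewrite hi hj => /eqP; rewrite !xpair_eqE; lia.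
rewrite -[RHS]card_ord -(card_imset _ f_inj); apply: eq_card => x.
rewrite !inE; apply/idP/imsetP => [|[i _ ->]]; last first.
  have := fE i; rewrite /sorted_triple /collapsible_triple /collapsible_triangle.
  have [[l ->]|[l ->]|[l ->]|[l ->]] := hP i (ltn_ord i);
  by case=> -> -> ->; move: (ltn_ord i); lia.
case: x => -[a b] c /andP[]; rewrite /sorted_triple /= => /andP[ab bc] col.
have ck := ltn_ord c.
have main i (ik : i < 2 * k - 1) : h i = (a : nat, b : nat, c : nat) ->
    exists2 x, x \in 'I_(2 * k - 1) & (a, b, c) = f x.
  move=> hi; exists (Ordinal ik) => //; have := fE (Ordinal ik).
  move: (f _) => [[a' b'] c']; rewrite /= hi.
  by case=> /val_inj -> /val_inj -> /val_inj ->.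
have h_eq i : i < 2 * k - 1 ->
  (i < k - 1 -> h i = (0, 1, i + 2)) /\ (i = k - 1 -> h i = (0, 2, 3)) /\
  ((k <= i < 2 * k - 2) -> h i = (1, i + 2 - k, k)) /\
  (i = 2 * k - 2 -> h i = (2, 3, k)).
  by move=> ik; have [[l ->]|[l ->]|[l ->]|[l ->]] := hP i ik; do !split=> //; lia.
move: col; rewrite /collapsible_triple /collapsible_triangle /=.
case/or4P; first by lia.
- case/andP=> a0 b1; have ik : c - 2 < 2 * k - 1 by lia.
  apply: (main _ ik); have [e _] := h_eq _ ik.
  by rewrite e; try lia; congr (_, _, _); lia.
- case/and3P=> a0 b1 c1; have ik : k - 1 < 2 * k - 1 by lia.
  apply: (main _ ik); have [_ [e _]] := h_eq _ ik.
  by rewrite e; try lia; congr (_, _, _); lia.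
case/orP=> [/andP[a1 c1]|/and3P[a1 b1 c1]].
- have ik : b + k - 2 < 2 * k - 1 by lia.
  apply: (main _ ik); have [_ [_ [e _]]] := h_eq _ ik.
  by rewrite e; try lia; congr (_, _, _); lia.
- have ik : 2 * k - 2 < 2 * k - 1 by lia.
  apply: (main _ ik); have [_ [_ [_ e]]] := h_eq _ ik.
  by rewrite e; try lia; congr (_, _, _); lia.
Qed.

Lemma card_critical_triples :
  #|[set x | sorted_triple x & ~~ collapsible_triple x]%SET| =
  (k - 3) * (k - 1) * (k + 4) %/ 6 - 1.
Proof.
have tot := card_sorted_triples k.+1.
have : #|[set x : triple | sorted_triple x]%SET| =
    (2 * k - 1) + #|[set x | sorted_triple x & ~~ collapsible_triple x]%SET|.
  rewrite -card_collapsible_triples -(cardsID [set x | collapsible_triple x]%SET).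
  by congr (_ + _); apply: eq_card => x; rewrite !inE // andbC.
rewrite [X in X = _]tot; set N := #|_| => cN.
(* The substitution removes the truncated subtractions, leaving a polynomial identity. *)
have [j kj] : exists j, k = j + 4 by exists (k - 4); lia.
have bE : 'C(k.+1, 3) * 6 = k.+1 * k * k.-1.
  by rewrite -[6]/(3`!) bin_ffact !ffactnS ffactn0 muln1 mulnA.
have -> : (k - 3) * (k - 1) * (k + 4) = (N + 1) * 6.
  by move: bE; rewrite cN kj; nia.
by rewrite mulnK // addnK.
Qed.

End count.

(** On pairs that are not chords [ch] takes the junk value [f0]. *)
Lemma chord_choice m (V : finType) (lft rgt : V -> nat) :
  cycle_chords m lft rgt -> 4 <= m ->
  exists ch : nat -> nat -> V, forall a b, a + 2 <= b -> b < m ->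
    (0 < a) || (b.+1 < m) -> lft (ch a b) = a /\ rgt (ch a b) = b.
Proof.
move=> cc m4; have [f0 _] := chord_ex cc (a := 0) (b := 2) ltac:(by []) ltac:(lia) ltac:(lia).
have ex (p : nat * nat) : exists e, p.1 + 2 <= p.2 -> p.2 < m ->
    (0 < p.1) || (p.2.+1 < m) -> lft e = p.1 /\ rgt e = p.2.
  have [h|nh] := pselect ([&& p.1 + 2 <= p.2, p.2 < m & (0 < p.1) || (p.2.+1 < m)]).
    by have /and3P[h1 h2 h3] := h; have [e he] := chord_ex cc h1 h2 h3; exists e.
  by exists f0 => h1 h2 h3; case: nh; rewrite h1 h2 h3.
have [ch chP] := choice ex.
by exists (fun a b => ch (a, b)) => a b; exact: (chP (a, b)).
Qed.

(** The cells are the triangles outside the list, parametrized by triples so that they can be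
    counted. They are maximal faces: no star contains a triangle, and all triangles have three
    sides. *)
Lemma chord_complex_large (R : realType) (k : nat) (V : finType)
    (lft rgt : V -> nat) : 4 <= k -> cycle_chords (k + 4) lft rgt ->
  homotopy_equivalent R
    (geom R (chord_complex lft rgt xpredT xpredT (fun _ _ => xpredT)))
    (wedge_spheres R ((k - 3) * (k - 1) * (k + 4) %/ 6 - 1) 2).
Proof.
move=> k4 cc; have m8 : 8 <= k + 4 by lia.
have lr e := cycle_lft_rgt e cc.
have [ch chP] := chord_choice cc ltac:(lia).
pose D := [set x : triple k | sorted_triple x & ~~ collapsible_triple x]%SET.
pose e1 (x : triple k) := ch (x.1.1 + 1) (x.1.2 + 2).
pose e2 (x : triple k) := ch (x.1.2 + 2) (x.2 + 3).
pose e3 (x : triple k) := ch (x.1.1 + 1) (x.2 + 3).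
pose cell x := [set e1 x; e2 x; e3 x]%SET.
have eP x : sorted_triple x ->
    [/\ lft (e1 x) = x.1.1 + 1 /\ rgt (e1 x) = x.1.2 + 2,
        lft (e2 x) = x.1.2 + 2 /\ rgt (e2 x) = x.2 + 3 &
        lft (e3 x) = x.1.1 + 1 /\ rgt (e3 x) = x.2 + 3].
  by move=> /andP[x1 x2]; have := ltn_ord x.2; split; apply: chP; lia.
have tP x : sorted_triple x -> triangle lft rgt (e1 x) (e2 x) (e3 x).
  by move=> /eP[[a1 b1] [a2 b2] [a3 b3]]; rewrite /triangle a1 b1 a2 b2 a3 b3 !eqxx.
have cell_inj : {in D &, injective cell}.
  move=> x y; rewrite !inE => /andP[sx _] /andP[sy _] /(triangle_inj lr (tP x sx) (tP y sy)).
  have [[a1 b1] [a2 b2] _] := eP x sx; have [[a1' b1'] [a2' b2'] _] := eP y sy.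
  case=> h1 h2 _; move: a1 b1 b2; rewrite h1 h2 a1' b1' b2'.
  case: x y {sx sy h1 h2 a2 a2' a1' b1' b2'} => [[a b] c] [[a' b'] c'] /=.
  move=> /addIn ea /addIn eb /addIn ec.
  by congr (_, _, _); apply: val_inj.
pose C := [set cell x | x in D]%SET.
have CP A : A \in C <-> exists f1 f2 f3, [/\ triangle lft rgt f1 f2 f3,
    ~~ collapsible_triangle (k + 4) (lft f1) (rgt f1) (rgt f2) &
    A = [set f1; f2; f3]%SET].
  split=> [/imsetP[x]|[f1 [f2 [f3 [tr nc ->]]]]].
    rewrite !inE => /andP[sx nx] ->; exists (e1 x), (e2 x), (e3 x).
    by have [[a1 b1] [a2 b2] _] := eP x sx; rewrite a1 b1 b2; split=> //; exact: tP.
  move: (tr) => /and3P[/eqP h1 /eqP h2 /eqP h3].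
  have g1 := chord_gap cc f1; have g2 := chord_gap cc f2.
  have bd := chord_bound cc f2.
  (* All triangles at 0 are listed, so subtracting 1, 2 and 3 decodes the vertices without
     truncation. *)
  have a0 : lft f1 != 0 by apply: contraNneq nc; rewrite /collapsible_triangle => ->.
  pose x : triple k := (inord (lft f1 - 1), inord (rgt f1 - 2), inord (rgt f2 - 3)).
  have [x1 x2 x3] : [/\ x.1.1 + 1 = lft f1, x.1.2 + 2 = rgt f1 & x.2 + 3 = rgt f2].
    by rewrite /x /=; split; rewrite inordK; lia.
  have sx : sorted_triple x by rewrite /sorted_triple; lia.
  apply/imsetP; exists x; first by rewrite inE sx /collapsible_triple x1 x2 x3.
  have [[a1 b1] [a2 b2] [a3 b3]] := eP x sx; have ext := chord_ext cc.
  rewrite /cell (ext f1 (e1 x)) ?a1 ?b1 ?x1 ?x2 //.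
  rewrite (ext f2 (e2 x)) ?a2 ?b2 ?x2 ?x3 //.
  by rewrite (ext f3 (e3 x)) ?a3 ?b3 ?x1 ?x3.
have cardC : #|C| = (k - 3) * (k - 1) * (k + 4) %/ 6 - 1.
  by rewrite card_in_imset // card_critical_triples.
rewrite -cardC; apply: wedge_of_cells.
- by move=> A B; apply: chord_complex_down.
- move=> A /CP[f1 [f2 [f3 [tr nc ->]]]]; split.
  + exact: (triangle_card lr tr).
  + by split=> //; right; exists f1, f2, f3.
  move=> B [_ [[v _ Bv]|[g1 [g2 [g3 [tr' _ ->]]]]]] sub.
    have := triangle_no_star lr v tr.
    by rewrite !Bv //; apply: (fintype.subsetP sub); rewrite !inE eqxx ?orbT.
  apply/eqP; rewrite eq_sym finset.eqEcard sub.
  by rewrite (triangle_card lr tr) (triangle_card lr tr').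
- rewrite cardC; have [j ->] : exists j, k = j + 4 by exists (k - 4); lia.
  by rewrite subn_gt0 leq_divRL //; nia.
have -> : geom R (fun A => chord_complex lft rgt xpredT xpredT (fun _ _ => xpredT) A /\
    A \notin C) = geom R (chord_complex lft rgt xpredT xpredT (collapsible_triangle (k + 4))).
  apply: geom_ext => A; split.
    case=> -[_ [[v _ Av]|[f1 [f2 [f3 [tr _ AE]]]]]] nA; split=> //.
      by left; exists v.
    right; exists f1, f2, f3; split=> //; apply: contraNT nA => nc.
    by apply/CP; exists f1, f2, f3.
  case=> _ [[v _ Av]|[f1 [f2 [f3 [tr Te AE]]]]].
    split; first by split=> //; left; exists v.
    apply/negP => /CP[f1 [f2 [f3 [tr _ AE]]]].
    have := triangle_no_star lr v tr.
    by rewrite !Av // AE !inE eqxx ?orbT.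
  split; first by split=> //; right; exists f1, f2, f3.
  apply/negP => /CP[g1 [g2 [g3 [tr' nc AE']]]].
  have [h1 h2 h3] := triangle_inj lr tr tr' (etrans (esym AE) AE').
  by move: nc; rewrite -h1 -h2 Te.
exact: collapsible_contractible.
Qed.

(** * Cycles with six and seven vertices *)

Section small.
Variables (R : realType) (m : nat) (V : finType) (lft rgt : V -> nat).
Hypothesis cc : cycle_chords m lft rgt.

Local Notation no_triangle := (fun _ _ => xpred0 : pred nat).

Let lr e : lft e < rgt e := cycle_lft_rgt e cc.

Definition star (E : pred V) (v : nat) : {set V} := [set e | E e && inc lft rgt v e]%SET.

(** A star of exactly two chords is an edge of the complex, and a maximal face because two chords
    share at most one end. Excluding the vertices in [Q] deletes just these edges: a single chord
    still lies in the star at its end outside [Q]. *)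
Lemma wedge_of_stars (E : pred V) (Q : seq nat) :
  uniq Q -> 0 < size Q -> (forall v, v \in Q -> #|star E v| = 2) ->
  (forall e, E e -> exists2 w, w \notin Q & inc lft rgt w e) ->
  contractible R (geom R (chord_complex lft rgt E [predC Q] no_triangle)) ->
  homotopy_equivalent R (geom R (chord_complex lft rgt E xpredT no_triangle))
    (wedge_spheres R (size Q) 1).
Proof.
move=> uQ Q0 star2 other ctr.
have common (A : {set V}) v w : #|A| = 2 -> (forall e, e \in A -> inc lft rgt v e) ->
    (forall e, e \in A -> inc lft rgt w e) -> v = w.
  move=> /eqP/cards2P[x [y [xy AE]]] Av Aw; apply/eqP; apply: contraNT xy => vw.
  apply/eqP; apply: (inc_inj lr (chord_ext cc) vw);
  by rewrite ?Av ?Aw // AE !inE eqxx ?orbT.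
have star_in E' v e : e \in star E' v -> inc lft rgt v e by rewrite inE => /andP[].
pose C := [set A | A \in [seq star E v | v <- Q]]%SET.
have cardC : #|C| = size Q.
  rewrite cardsE -(size_map (star E)); apply/card_uniqP.
  rewrite map_inj_in_uniq // => v w vQ wQ vw.
  apply: (common _ _ _ (star2 v vQ)) => e; first exact: star_in.
  by rewrite vw; exact: star_in.
rewrite -cardC; apply: wedge_of_cells; rewrite ?cardC //.
- by move=> A B; apply: chord_complex_down.
- move=> A; rewrite inE => /mapP[v vQ ->]; split; first exact: star2.
    split; first by move=> e; rewrite inE => /andP[].
    by left; exists v => // e; exact: star_in.
  move=> B [BE [[w _ Bw]|[e1 [e2 [e3 []//]]]]] sub.
  have wv : w = v.
    apply: (common _ _ _ (star2 v vQ)) => e; last exact: star_in.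
    by move=> /(fintype.subsetP sub); exact: Bw.
  apply/eqP; rewrite finset.eqEsubset sub andbT; apply/fintype.subsetP => e eB.
  by rewrite inE BE //= -wv Bw.
have <- : geom R (chord_complex lft rgt E [predC Q] no_triangle) =
  geom R (fun A => chord_complex lft rgt E xpredT no_triangle A /\ A \notin C); last by [].
apply: geom_ext => A; split.
  case=> AE [[w /= wQ Aw]|[e1 [e2 [e3 []//]]]].
  split; first by split=> //; left; exists w.
  rewrite inE; apply/mapP => -[v vQ AEs]; move/negP: wQ; apply.
  rewrite (common A w v _ Aw) ?AEs //; first exact: star2.
  by move=> e; exact: star_in.
case=> -[AE [[v _ Av]|[e1 [e2 [e3 []//]]]]] nC; split=> //; left.
have [vQ|vQ] := boolP (v \in Q); last by exists v.
have sub : A \subset star E v.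
  by apply/fintype.subsetP => e eA; rewrite inE AE //= Av.
have A1 : #|A| <= 1.
  rewrite -ltnS -(star2 v vQ); apply: proper_card; rewrite finset.properEneq sub andbT.
  apply: contraNneq nC => ->; rewrite inE; apply/mapP; by exists v.
(* Even the empty face needs some star outside [Q]; one is found at the other end of a chord at a
   vertex of [Q]. *)
have [A0|/set0Pn[e eA]] := eqVneq A finset.set0.
  case: Q Q0 vQ star2 other {uQ C cardC nC ctr} => // q Q _ _ star2 other.
  have /card_gt0P[e] : 0 < #|star E q| by rewrite star2 ?mem_head.
  rewrite inE => /andP[Ee _]; have [w wQ _] := other e Ee.
  by exists w => // a; rewrite A0 inE.
have [w wQ we] := other e (AE e eA); exists w => // a aA.
have -> // : a = e by move/card_le1_eqP: A1; apply.
Qed.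

(** Pruning of leaves: [f] meets [e] at [y] and also contains every end in [P] at which [e] meets a
    chord still present. Thus [f] dominates [e], the case [f = g] of the deletion. *)
Lemma tree_contractible (E : pred V) (P : pred nat) (r : V -> nat) (top : nat) e0 v0 :
  E e0 -> P v0 -> inc lft rgt v0 e0 -> (forall e, E e -> top <= r e -> e = e0) ->
  (forall e, E e -> r e < top -> exists f y,
    [/\ E f, r e < r f, P y /\ inc lft rgt y e, inc lft rgt y f &
      forall v u, P v -> inc lft rgt v e -> inc lft rgt v u -> u != e -> E u ->
        r e <= r u -> inc lft rgt v f]) ->
  top <= r e0 ->
  contractible R (geom R (chord_complex lft rgt E P no_triangle)).
Proof.
move=> Ee0 Pv0 ve0 e0_uniq step r0.
apply: (contractible_equivalent (@chord_complex_strip _ _ _ lr (chord_ext cc)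
  E P _ _ R r top _)) => // [e Ee /(step e Ee)|].
  move=> [f [y [Ef ef [Py ye] yf st]]]; exists f, f; split=> //.
  - apply: (@chord_complex_star _ _ _ _ _ _ _ y) => // a.
    by rewrite !inE -orbA => /or3P[] /eqP ->; rewrite ?Ee ?Ef.
  - by move=> v u Pv ve vu ue Eu ru; rewrite (st v u).
apply: (@point_contractible _ _ _ e0) => [|A [AE _]].
  apply: (@chord_complex_star _ _ _ _ _ _ _ v0) => // e.
  by rewrite inE => /eqP ->; rewrite Ee0 r0.
apply/fintype.subsetP => e /AE /andP[Ee re]; rewrite inE; apply/eqP.
exact: e0_uniq.
Qed.

End small.

(** * Checking the collapse of a small cycle by computation *)

Section certificate.
Variable m : nat.

Definition is_chord (p : nat * nat) : bool :=
  [&& p.1 + 2 <= p.2, p.2 < m & (0 < p.1) || (p.2.+1 < m)].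

Definition all_chords : seq (nat * nat) :=
  [seq p <- allpairs pair (iota 0 m) (iota 0 m) | is_chord p].

Definition all_triples : seq (nat * nat * nat) :=
  [seq t <- allpairs pair all_chords (iota 0 m) |
    is_chord (t.1.2, t.2) && is_chord (t.1.1, t.2)].

Definition edges (t : nat * nat * nat) : seq (nat * nat) :=
  [:: t.1; (t.1.2, t.2); (t.1.1, t.2)].

Definition on (v : nat) (p : nat * nat) : bool := (v == p.1) || (v == p.2).

(* [D] lists chords that are removed through the only triangle containing
   them, [Q] the vertices whose stars become the cells, and [L] the remaining
   chords, in the order in which the complement of these cells collapses. *)
Definition certificate (D L : seq (nat * nat)) (Q : seq nat) : bool :=
  [&& all (fun p => has (fun t => [&& p \in edges t,
        all (fun q => (q == p) || (q \notin D)) (edges t) &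
        all (fun t' => (p \in edges t') ==> (t' == t)) all_triples]) all_triples) D,
      all (fun t => has (mem D) (edges t)) all_triples,
      uniq L && all is_chord L,
      all (fun p => (p \in L) == (p \notin D)) all_chords,
      [&& uniq Q, 0 < size Q & all (fun v => count (on v) L == 2) Q],
      all (fun p => (p.1 \notin Q) || (p.2 \notin Q)) L &
      all (fun p => (index p L == (size L).-1) ||
        has (fun q => [&& index p L < index q L,
            has (fun y => (y \notin Q) && on y q) [:: p.1; p.2] &
            all (fun v => (v \notin Q) ==>
              all (fun u => [&& on v u, u != p & index p L <= index u L] ==> on v q) L)
              [:: p.1; p.2]]) L) L].

End certificate.

Lemma chord_complex_small (R : realType) (m : nat) (V : finType)
    (lft rgt : V -> nat) (D L : seq (nat * nat)) (Q : seq nat) :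
  cycle_chords m lft rgt -> certificate m D L Q ->
  homotopy_equivalent R
    (geom R (chord_complex lft rgt xpredT xpredT (fun _ _ => xpredT)))
    (wedge_spheres R (size Q) 1).
Proof.
move=> cc /and5P[/allP tri /allP hit /andP[uL /allP Lch] /allP LD].
move=> /and3P[/and3P[uQ Q0 /allP star2] /allP other /allP tree].
have lr e := cycle_lft_rgt e cc; have ext := chord_ext cc.
pose ends e := (lft e, rgt e).
have ends_chord e : is_chord m (ends e).
  by rewrite /is_chord /= (chord_gap cc) (chord_bound cc) (chord_wrap cc).
have ends_in e : ends e \in all_chords m.
  rewrite mem_filter ends_chord; apply/allpairsP; exists (ends e).
  by rewrite !mem_iota /=; have := chord_bound cc e; have := lr e; split=> //; lia.
have ends_inj : injective ends by move=> e f [le re]; exact: ext.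
have ends_ex p : is_chord m p -> exists e, ends e = p.
  case: p => a b /and3P[h1 h2 h3]; have [e [le re]] := chord_ex cc h1 h2 h3.
  by exists e; rewrite /ends le re.
have triple_in e1 e2 e3 : triangle lft rgt e1 e2 e3 ->
    (lft e1, rgt e1, rgt e2) \in all_triples m /\
    edges (lft e1, rgt e1, rgt e2) = [:: ends e1; ends e2; ends e3].
  move=> /and3P[/eqP h1 /eqP h2 /eqP h3].
  have c2 : (rgt e1, rgt e2) = ends e2 by rewrite /ends h2.
  have c3 : (lft e1, rgt e2) = ends e3 by rewrite /ends h1 h3.
  split; last by rewrite /edges /= c2 c3.
  rewrite mem_filter /= c2 c3 !ends_chord.
  apply/allpairsP; exists (ends e1, rgt e2); split=> //=.
  by rewrite mem_iota /=; exact: (chord_bound cc).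
have in_L e : (ends e \in L) = (ends e \notin D) by apply/eqP; exact: LD.
have on_inc v e : on v (ends e) = inc lft rgt v e by [].
(* All of [D] gets rank 0, so its chords may go in any order: the triangle through which one is
   removed has no other side in [D]. *)
pose r1 e : nat := ends e \notin D.
pose E e := true && (1 <= r1 e).
have EL e : E e = (ends e \in L) by rewrite in_L /E /r1 lt0b.
have strip1 : homotopy_equivalent R
    (geom R (chord_complex lft rgt xpredT xpredT (fun _ _ => xpredT)))
    (geom R (chord_complex lft rgt E xpredT (fun _ _ => xpredT))).
  apply: (@chord_complex_strip _ _ _ lr ext) => // e _.
  rewrite /r1 ltnS leqn0 eqb0 negbK => eD; rewrite eD.
  have /hasP[t tin /and3P[et /allP etD /allP t_uniq]] := tri _ eD.
  have [e1 [e2 [e3 [tr tE eE]]]] : exists e1 e2 e3,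
      [/\ triangle lft rgt e1 e2 e3, t = (lft e1, rgt e1, rgt e2) &
          edges t = [:: ends e1; ends e2; ends e3]].
    case: t tin {et etD t_uniq} => -[a b] c.
    rewrite mem_filter => /andP[/andP[/= /ends_ex[e2 h2] /ends_ex[e3 h3]]].
    move=> /allpairsP[[p x] /= [+ _ [pab xc]]].
    rewrite -pab mem_filter => /andP[/ends_ex[e1 h1] _].
    exists e1, e2, e3; case: h1 => l1 r1'; case: h2 => l2 r2; case: h3 => l3 r3.
    rewrite /triangle /edges /ends /= l1 r1' l2 r2 l3 r3 !eqxx.
    by split.
  have mem3 f : (f \in [set e1; e2; e3]%SET) = (ends f \in edges t).
    by rewrite eE !inE !(inj_eq ends_inj) orbA.
  have others f : f \in [set e1; e2; e3]%SET -> f != e -> ends f \notin D.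
    by rewrite mem3 => /etD; rewrite (inj_eq ends_inj) => /orP[/eqP->|//]; rewrite eqxx.
  have eT : e \in [set e1; e2; e3]%SET by rewrite mem3.
  have [f [g [sE ef eg st]]] := triangle_split lr tr eT.
  have fD : ends f \notin D.
    by apply: others; rewrite -?sE ?inE ?eqxx ?orbT // eq_sym.
  have gD : ends g \notin D.
    by apply: others; rewrite -?sE ?inE ?eqxx ?orbT // eq_sym.
  exists f, g; rewrite fD gD; split=> //.
  - by split=> //; right; exists e1, e2, e3; split.
  - by move=> v u _ ve _ _ _ _; exact: st.
  move=> f1 f2 f3 tr' _ _ _ _ ef'; have [tin' eE'] := triple_in _ _ _ tr'.
  have /eqP t't : (lft f1, rgt f1, rgt f2) == t.
    apply: (implyP (t_uniq _ tin')); rewrite eE' !inE !(inj_eq ends_inj).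
    by move: ef'; rewrite !inE orbA.
  apply/fintype.subsetP => h; rewrite sE mem3 -t't eE'.
  by rewrite !inE !(inj_eq ends_inj) orbA.
apply: (homotopy_equivalent_trans strip1).
(* No triangle survives, since each has a side in [D]. *)
have -> : geom R (chord_complex lft rgt E xpredT (fun _ _ => xpredT)) =
    geom R (chord_complex lft rgt E xpredT (fun _ _ => xpred0)).
  apply: geom_ext => A; split=> -[AE [h|[e1 [e2 [e3 []//]]]]]; first 1 last.
  2: by split=> //; left.
  2: by split=> //; left.
  move=> tr _ A3; have [tin eE] := triple_in _ _ _ tr.
  have /hasP[p] := hit _ tin; rewrite eE.
  have nD f : f \in [set e1; e2; e3]%SET -> ends f \notin D.
    by rewrite -A3 => /AE; rewrite EL in_L.
  rewrite !inE => /or3P[] /eqP -> /=.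
  - by rewrite (negbTE (nD e1 _)) // !inE eqxx.
  - by rewrite (negbTE (nD e2 _)) // !inE eqxx orbT.
  - by rewrite (negbTE (nD e3 _)) // !inE eqxx orbT.
have otherP e : E e -> exists2 w, w \notin Q & inc lft rgt w e.
  rewrite EL => /other /orP[] h; first by exists (lft e); rewrite // /inc eqxx.
  by exists (rgt e); rewrite // /inc eqxx orbT.
apply: (wedge_of_stars cc) => //.
  move=> v vQ; rewrite -(eqP (star2 v vQ)) -size_filter cardE -(size_map ends).
  apply: perm_size; apply: uniq_perm.
  - by rewrite map_inj_uniq // enum_uniq.
  - exact: filter_uniq.
  move=> p; rewrite mem_filter; apply/mapP/andP => [[e]|[vp pL]].
    by rewrite mem_enum inE EL => /andP[eL ve] ->.
  have [e pe] := ends_ex _ (Lch p pL); exists e; rewrite // mem_enum inE EL pe pL.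
  by rewrite -on_inc pe.
have L0 : 0 < size L.
  case: L star2 {uL Lch LD other tree in_L E EL strip1 otherP} => // star2.
  by case: Q Q0 star2 {uQ} => // q Q' _ /(_ q (mem_head _ _)).
pose p0 := nth (0, 0) L (size L).-1.
have p0L : p0 \in L by apply: mem_nth; rewrite prednK.
have [e0 e0p] := ends_ex _ (Lch _ p0L).
have Ee0 : E e0 by rewrite EL e0p.
have [v0 v0Q v0e] := otherP e0 Ee0.
(* The position in [L] serves as rank, and the last chord of [L] is the point that remains. *)
apply: (@tree_contractible R m V lft rgt cc E [predC Q] (fun e => index (ends e) L)
  (size L).-1 e0 v0) => //.
- move=> e; rewrite EL => eL /= ei; apply: ends_inj; rewrite e0p /p0.
  have := nth_index (0, 0) eL; have : index (ends e) L = (size L).-1.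
    by move: eL; rewrite -index_mem => eL; apply/eqP; rewrite eqn_leq ei andbT -ltnS prednK.
  by move=> ->.
- move=> e; rewrite EL => eL /= ei; have /orP[/eqP eq_i|] := tree _ eL.
    by rewrite eq_i ltnn in ei.
  move=> /hasP[q qL /and3P[iq /hasP[y ye /andP[yQ yq]] /allP stq]].
  have [f fq] := ends_ex _ (Lch q qL); exists f, y; split.
  + by rewrite EL fq.
  + by rewrite fq.
  + by split=> //; move: ye; rewrite !inE.
  + by rewrite -on_inc fq.
  move=> v u vQ ve vu ue; rewrite EL => uL' iu.
  have ve' : v \in [:: (ends e).1; (ends e).2] by rewrite !inE.
  have := stq v ve'; rewrite [v \notin Q]vQ /= => /allP/(_ _ uL').
  by rewrite on_inc vu iu (inj_eq ends_inj) ue /= -on_inc fq.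
- by rewrite e0p /p0 index_uniq // prednK.
Qed.

Lemma wedge_single (R : realType) (d : nat) :
  homotopy_equivalent R (wedge_spheres R 1 d) (sphere R d).
Proof.
pose base (i : 'I_1) := sphere_base R d.
pose X := fun _ : 'I_1 => sphere R d.
pose f (i : 'I_1) (q : X i) : sphere R d := q.
have funE i (q : X i) : wedge_fun f (@wedge_lift _ X base i q) = q.
  by rewrite wedge_lift_funE.
apply: (@homotopy_equivalent_homeo R _ _
  (@wedge_fun _ X base _ f) (@wedge_lift _ X base ord0)).
- by apply: wedge_fun_continuous => // i x U.
- exact: (@wedge_lift_continuous _ X base ord0).
- move=> w; have : [set: wedge_spheres R 1 d] w by [].
  rewrite -[X in X w]wedgeTE => -[i _ [q _ <-]].
  by rewrite (funE i q) (ord1 i).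
- by move=> q; exact: (funE ord0).
Qed.

Theorem theorem1p2 (R : realType) :
  (forall k : nat, (4 <= k)%N ->
    homotopy_equivalent R (realization R (Ind (@SG 2 k)))
      (wedge_spheres R (((k - 3) * (k - 1) * (k + 4)) %/ 6 - 1) 2)) /\
  homotopy_equivalent R (realization R (Ind (@SG 2 2))) (wedge_spheres R 2 1) /\
  homotopy_equivalent R (realization R (Ind (@SG 2 3))) (sphere R 1).
Proof.
split=> [k k4|].
  have [lft [rgt [cc SGE]]] := SG_chords k.
  by rewrite (realization_SG R cc SGE); exact: chord_complex_large.
split.
  have [lft [rgt [cc SGE]]] := SG_chords 2; rewrite (realization_SG R cc SGE).
  (* The triangles of the hexagon are {0, 2, 4} and {1, 3, 5}; [D] takes a side of each. In the
     graph that is left, 0 and 1 have two chords each, and splitting the graph at both gives a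
     tree. *)
  pose D := [:: (0, 2); (1, 3)].
  pose L := [:: (0, 3); (0, 4); (1, 4); (1, 5); (3, 5); (2, 4); (2, 5)].
  by apply: (@chord_complex_small R 6 _ lft rgt D L [:: 0; 1]).
have [lft [rgt [cc SGE]]] := SG_chords 3; rewrite (realization_SG R cc SGE).
(* Each independent triangle of the heptagon has exactly one side joining vertices at distance 3,
   and [D] lists the seven chords of this kind. The chords in [L], at distance 2, form a single
   closed path, cut open at 0. *)
pose D := [:: (0, 4); (1, 5); (2, 6); (0, 3); (1, 4); (2, 5); (3, 6)].
pose L := [:: (0, 2); (2, 4); (4, 6); (1, 6); (1, 3); (3, 5); (0, 5)].
apply: homotopy_equivalent_trans (wedge_single R 1).
by apply: (@chord_complex_small R 7 _ lft rgt D L [:: 0]).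
Qed.
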